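(* Let $M,N\le\infty$ and consider the operator $L=a(x)\frac{d^2}{dx^2}+b(x)\frac{d}{dx}$ on $(-M,N)$ with reflecting boundaries at $-M$ if $M<\infty$ and at $N$ if $N<\infty$. Let $a>0$, and let $a$ and $b$ be continuous on $[-M,N]$ (an infinite endpoint being excluded, e.g. on $(-M,N]$ if $M=\infty$). Assume $\mu(-M,N)<\infty$. Then for $\lambda_1$ (defined in the context) we have the basic estimate $\kappa^{-1}/4\le\lambda_1\le\kappa^{-1}$, where $$\kappa^{-1}=\inf_{-M<x<y<N}\Big[\Big(\int_{-M}^xd\mu\Big)^{-1}+\Big(\int_y^Nd\mu\Big)^{-1}\Big]\Big(\int_x^yd\nu\Big)^{-1}.$$
   Context: Fix a reference point $\theta\in(-M,N)$ and put $C(x)=\int_\theta^x\frac{b}{a}$. Scale measure: $\nu(dx)=e^{-C(x)}dx$. Speed measure: $\mu(dx)=\frac{e^{C(x)}}{a(x)}dx$. Let $\pi=\mu/\mu(-M,N)$, let $\mathscr A$ be the set of absolutely continuous functions in $(-M,N)$, $\|\cdot\|$ the norm of $L^2(\mu)$, $D(f)=\int_{-M}^Na\,f'^2\,d\mu$ for $f\in\mathscr A$, and $$\lambda_1=\inf\{D(f):\ f\in L^2(\mu)\cap\mathscr A,\ \pi(f)=0,\ \|f\|=1\}.$$ *)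

(* Defs.v *)
From HB Require Import structures.
From mathcomp Require Import all_boot all_order all_algebra.
From mathcomp Require Import all_classical all_reals all_analysis.
From mathcomp Require Import measurable_realfun.

Set Implicit Arguments.
Unset Strict Implicit.
Unset Printing Implicit Defensive.

Import Order.TTheory GRing.Theory Num.Theory.
Import numFieldNormedType.Exports.

Local Open Scope classical_set_scope.
Local Open Scope ring_scope.

(** The measure [w(x) dx] on [D], extended by zero to the whole line. *)
Section density_measure.
Context {R : realType}.
Variables (D : set R) (w : R -> R).
Hypothesis mD : measurable D.
Hypothesis mw : measurable_fun D w.
Hypothesis w_ge0 : forall x, D x -> 0 <= w x.

Definition density_measure of measurable D & measurable_fun D w
    & (forall x, D x -> 0 <= w x) : set (measurableTypeR R) -> \bar R :=
  fun A => (\int[@lebesgue_measure R]_(x in A `&` D) (w x)%:E)%E.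

Local Notation dm := (density_measure mD mw w_ge0).

Let dm0 : dm set0 = 0%E.
Proof. by rewrite /density_measure set0I integral_set0. Qed.

Let dm_ge0 A : (0 <= dm A)%E.
Proof.
by apply: integral_ge0 => x [_ Dx]; rewrite lee_fin w_ge0.
Qed.

Let dm_sigma_additive : semi_sigma_additive dm.
Proof.
move=> F mF tF mUF; rewrite /density_measure setI_bigcupl.
rewrite ge0_integral_bigcup//=.
- apply: is_cvg_ereal_nneg_natsum_cond => n _ _.
  by apply: integral_ge0 => x [_ Dx]; rewrite lee_fin w_ge0.
- by move=> k; exact: measurableI.
- apply/measurable_EFinP; apply: measurable_funS mw => //.
  by apply: bigcup_sub => k _ x [].
- by move=> x [k _ [_ Dx]]; rewrite lee_fin w_ge0.
- apply/trivIsetP => i j _ _ ij.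
  move/trivIsetP : tF => /(_ i j Logic.I Logic.I ij).
  by rewrite setIACA => ->; rewrite set0I.
Qed.

HB.instance Definition _ := isMeasure.Build _ _ _ dm
  dm0 dm_ge0 dm_sigma_additive.

End density_measure.

Section diffusion.
Context {R : realType}.
Implicit Types (M N : \bar R) (theta u v x y : R) (a b f : R -> R).

Definition state_space M N : set R := [set x | (- M < x%:E < N)%E].

(** As [x] ranges over the reals, an infinite endpoint is never included. *)
Definition closed_state_space M N : set R := [set x | (- M <= x%:E <= N)%E].

Definition oriented_integral f u v : R :=
  if u <= v then \int[@lebesgue_measure R]_(t in `[u, v]) f t
  else - \int[@lebesgue_measure R]_(t in `[v, u]) f t.

Definition C_ theta a b x : R :=
  oriented_integral (fun t => b t / a t) theta x.

Definition scale_density theta a b x : R := expR (- C_ theta a b x).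

Definition speed_density theta a b x : R := expR (C_ theta a b x) / a x.

Definition absolutely_continuous_on u v f : Prop :=
  forall e : R, 0 < e -> exists2 d : R, 0 < d &
    forall (n : nat) (p q : nat -> R),
      (forall i, (i < n)%N -> [/\ u <= p i, p i <= q i & q i <= v]) ->
      trivIset `I_n (fun i => `]p i, q i[%classic) ->
      \sum_(i < n) (q i - p i) < d ->
      \sum_(i < n) `|f (q i) - f (p i)| < e.

(** Absolute continuity in an open interval is meant on each of its compact
    subintervals. *)
Definition absolutely_continuous_in M N f : Prop :=
  forall u v, state_space M N u -> state_space M N v ->
    absolutely_continuous_on u v f.

Section measurability.
Variables (M N : \bar R) (theta : R) (a b : R -> R).
Hypothesis Itheta : state_space M N theta.
Hypothesis ca : {within closed_state_space M N, continuous a}.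
Hypothesis cb : {within closed_state_space M N, continuous b}.
Hypothesis a_gt0 : forall x, closed_state_space M N x -> 0 < a x.

Lemma open_state_space : open (state_space M N).
Proof.
rewrite /state_space.
have -> : [set x : R | (- M < x%:E < N)%E] =
    [set x | (- M < x%:E)%E] `&` [set x | (x%:E < N)%E].
  by apply/seteqP; split => x /= => [/andP[]|[-> ->]].
apply: openI.
- case: M => [m| |] /=.
  + rewrite (_ : mkset _ = [set x | - m < x]); first exact: open_gt.
    by apply/seteqP; split => x /=; rewrite lte_fin.
  + rewrite (_ : mkset _ = setT); first exact: openT.
    by apply/seteqP; split => x //= _; rewrite ltNyr.
  + rewrite (_ : mkset _ = set0); first exact: open0.
    by apply/seteqP; split => x //=; rewrite ltNge leey.
- case: N => [m| |] /=.
  + rewrite (_ : mkset _ = [set x | x < m]); first exact: open_lt.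
    by apply/seteqP; split => x /=; rewrite lte_fin.
  + rewrite (_ : mkset _ = setT); first exact: openT.
    by apply/seteqP; split => x //= _; rewrite ltry.
  + rewrite (_ : mkset _ = set0); first exact: open0.
    by apply/seteqP; split => x //=; rewrite ltNge leNye.
Qed.

Lemma measurable_state_space : measurable (state_space M N).
Proof. apply: open_measurable; exact: open_state_space. Qed.

Lemma state_space_itvcc u v : state_space M N u -> state_space M N v ->
  `[u, v] `<=` state_space M N.
Proof.
move=> /andP[Mu _] /andP[_ vN] x /=; rewrite in_itv/= => /andP[ux xv].
rewrite /state_space/=; apply/andP; split.
  by rewrite (lt_le_trans Mu)// lee_fin.
by rewrite (le_lt_trans _ vN)// lee_fin.
Qed.

Lemma state_space_closed : state_space M N `<=` closed_state_space M N.
Proof.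
by move=> x /andP[? ?]; rewrite /closed_state_space/=; apply/andP; split;
  exact: ltW.
Qed.

Lemma drift_continuous :
  {in state_space M N, continuous (fun t => b t / a t)}.
Proof.
have caI := continuous_subspaceW state_space_closed ca.
have cbI := continuous_subspaceW state_space_closed cb.
rewrite continuous_open_subspace in caI; last exact: open_state_space.
rewrite continuous_open_subspace in cbI; last exact: open_state_space.
move=> x Ix; apply: cvgM; first exact: cbI.
apply: cvgV; last exact: caI.
by rewrite gt_eqF// a_gt0//; apply: state_space_closed; rewrite inE in Ix.
Qed.

Lemma state_space_lt x : state_space M N x ->
  exists2 u, u < x & state_space M N u.
Proof.
move=> /(open_subball open_state_space)[e /= e0 /(_ (e / 2))/=].
rewrite sub0r normrN gtr0_norm ?divr_gt0// => /(_ _ _)/= h.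
exists (x - e / 4); first by rewrite ltrBlDr ltrDl divr_gt0.
apply: h; rewrite ?divr_gt0//.
  by rewrite ltr_pdivrMr// ltr_pMr// ltr1n.
rewrite /ball/= opprB addrCA subrr addr0 gtr0_norm ?divr_gt0//.
by rewrite ltr_pM2l// ltf_pV2 ?posrE// ltr_nat.
Qed.

Lemma state_space_gt x : state_space M N x ->
  exists2 v, x < v & state_space M N v.
Proof.
move=> /(open_subball open_state_space)[e /= e0 /(_ (e / 2))/=].
rewrite sub0r normrN gtr0_norm ?divr_gt0// => /(_ _ _)/= h.
exists (x + e / 4); first by rewrite ltrDl divr_gt0.
apply: h; rewrite ?divr_gt0//.
  by rewrite ltr_pdivrMr// ltr_pMr// ltr1n.
rewrite /ball/= opprD addrA subrr sub0r normrN gtr0_norm ?divr_gt0//.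
by rewrite ltr_pM2l// ltf_pV2 ?posrE// ltr_nat.
Qed.

Lemma C_continuous : {in state_space M N, continuous (C_ theta a b)}.
Proof.
move=> x /[!inE] Ix.
have [u [Iu ux ut]] : exists u, [/\ state_space M N u, u < x & u < theta].
  case: (leP x theta) => xt.
    by have [u ux Iu] := state_space_lt Ix; exists u; split => //; exact: lt_le_trans xt.
  have [u ux Iu] := state_space_lt Itheta.
  by exists u; split => //; exact: lt_trans xt.
have [v [Iv xv tv]] : exists v, [/\ state_space M N v, x < v & theta < v].
  case: (leP x theta) => xt.
    have [v tv Iv] := state_space_gt Itheta.
    by exists v; split => //; exact: le_lt_trans tv.
  by have [v xv Iv] := state_space_gt Ix; exists v; split => //; exact: lt_trans xv.
pose f t := b t / a t.
pose P y := parameterized_integral (@lebesgue_measure R) u y f.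
have intf : (@lebesgue_measure R).-integrable `[u, v] (EFin \o f).
  apply: continuous_compact_integrable; first exact: segment_compact.
  apply: continuous_in_subspaceT => y /[!inE] /(state_space_itvcc Iu Iv) Iy.
  by apply: drift_continuous; rewrite inE.
have uv : u < v by exact: lt_trans xv.
have PB y z : u <= y -> y <= z -> z <= v ->
    \int[@lebesgue_measure R]_(t in `[y, z]) f t = P z - P y.
  move=> uy yz zv.
  have intuz : (@lebesgue_measure R).-integrable `[u, z] (EFin \o f).
    by apply: integrableS intf => //; apply: subset_itvl; rewrite bnd_simp.
  rewrite /P /parameterized_integral Rintegral_itvB ?bnd_simp//.
  rewrite Rintegral_itv_obnd_cbnd//.
  apply: integrableS intuz => //; apply: subset_itvr.
  by rewrite bnd_simp.
have CP : {in `]u, v[, forall y, P y - P theta = C_ theta a b y}.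
  move=> y; rewrite in_itv/= => /andP[uy yv].
  rewrite /C_ /oriented_integral; case: leP => ty.
    by rewrite PB// ltW.
  by rewrite PB ?opprB// ltW.
have [cP _ _] := (continuous_within_itvP P uv).1
  (parameterized_integral_continuous (ltW uv) intf).
have xuv : x \in `]u, v[ by rewrite in_itv/= ux.
rewrite /continuous_at -CP//.
apply: cvg_trans (cvgB (cP _ xuv) (cvg_cst (P theta))).
apply: near_eq_cvg; near=> y; rewrite /= -CP//.
by near: y; exact: near_in_itvoo.
Unshelve. all: by end_near. Qed.

Lemma measurable_scale_density :
  measurable_fun (state_space M N) (scale_density theta a b).
Proof.
apply: open_continuous_measurable_fun; first exact: open_state_space.
move=> x Ix; rewrite /scale_density.
apply: continuous_comp; last exact: continuous_expR.
by apply: continuousN; exact: C_continuous.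
Qed.

Lemma measurable_speed_density :
  measurable_fun (state_space M N) (speed_density theta a b).
Proof.
have caI := continuous_subspaceW state_space_closed ca.
rewrite continuous_open_subspace in caI; last exact: open_state_space.
apply: open_continuous_measurable_fun; first exact: open_state_space.
move=> x Ix; rewrite /speed_density.
apply: cvgM.
  by apply: continuous_comp; [exact: C_continuous|exact: continuous_expR].
apply: cvgV; last exact: caI.
by rewrite gt_eqF// a_gt0//; apply: state_space_closed; rewrite inE in Ix.
Qed.

Lemma scale_density_ge0 x : state_space M N x -> 0 <= scale_density theta a b x.
Proof. by move=> _; exact: expR_ge0. Qed.

Lemma speed_density_ge0 x : state_space M N x -> 0 <= speed_density theta a b x.
Proof.
move=> /state_space_closed/a_gt0 ax; apply: divr_ge0; first exact: expR_ge0.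
exact: ltW.
Qed.

Definition scale_measure : {measure set (measurableTypeR R) -> \bar R} :=
  density_measure measurable_state_space measurable_scale_density
    scale_density_ge0.

Definition speed_measure : {measure set (measurableTypeR R) -> \bar R} :=
  density_measure measurable_state_space measurable_speed_density
    speed_density_ge0.

End measurability.

Section constants.
Local Open Scope ereal_scope.
Variables (M N : \bar R) (theta : R) (a : R -> R).
Variables mu nu : {measure set (measurableTypeR R) -> \bar R}.

(** Since [0 < mu setT < +oo], [mnormalize] returns [mu / mu setT]; its second
    argument is a dummy value for the degenerate cases. *)
Definition stationary_distribution : probability (measurableTypeR R) R :=
  mnormalize mu \d_(theta : measurableTypeR R).

(** An absolutely continuous function is differentiable almost everywhere, and
    [derive1 f] is its derivative there; [derive1] is total, and its values on
    the remaining null set do not matter. *)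
Definition dirichlet_form (f : R -> R) : \bar R :=
  \int[mu]_(x in state_space M N) (a x * derive1 f x ^+ 2)%:E.

Definition admissible : set (R -> R) := [set f |
  [/\ (f : measurableTypeR R -> R) \in Lfun mu 2%:E,
      absolutely_continuous_in M N f,
      \int[stationary_distribution]_x (f x)%:E = 0 &
      'N[mu]_2%:E[EFin \o f] = 1]].

Definition lambda1 : \bar R := ereal_inf (dirichlet_form @` admissible).

Definition kappa_inv : \bar R := ereal_inf
  [set ((mu (state_space M N `&` [set` `]-oo, xy.1]]))^-1
        + (mu (state_space M N `&` [set` `[xy.2, +oo[]))^-1)
       * (nu [set` `[xy.1, xy.2]])^-1
  | xy in [set xy : R * R |
      [/\ state_space M N xy.1, state_space M N xy.2 & (xy.1 < xy.2)%R]]].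

End constants.
End diffusion.

(* Main.v *)
From HB Require Import structures.
Require Import Defs.
From mathcomp Require Import all_boot all_order all_algebra.
From mathcomp Require Import all_classical all_reals all_analysis.
From mathcomp Require Import measurable_realfun ring lra.

Set Implicit Arguments.
Unset Strict Implicit.
Unset Printing Implicit Defensive.

Import Order.TTheory GRing.Theory Num.Theory.
Import numFieldNormedType.Exports.

Local Open Scope classical_set_scope.
Local Open Scope ring_scope.

(** Write [s] and [h] for the scale and speed densities, [sigma] for a
    primitive of [s], [A x] for the mass of [(-M, x]] and [B y] for that of
    [[y, N)]. Since [a h = 1 / s], the Dirichlet form is the integral of
    [f'^2 / s].

    Upper bound: for [x < y], test with [sigma] stopped outside [[x, y]],
    centered and normalized. Its energy before normalization is
    [S = sigma y - sigma x], and its variance is at least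
    [S^2 / (1 / A x + 1 / B y)] because it is constant on both sides.

    Lower bound: with [K = kappa], the definition of [kappa] reads
    [sigma y - K / B y <= sigma x + K / A x], so some level [sigma m] separates
    the two sides. Hence [(sigma y - sigma m) B y <= K] on the right of [m] and
    [(sigma m - sigma x) A x <= K] on its left, and Muckenhoupt's weighted Hardy
    inequality with constant [4 K] applies to [f - f m] on each side. The Hardy
    inequality comes from an explicit Riccati supersolution, the singularity at
    [m] being removed by replacing [K] with [K' > K].

    An absolutely continuous function is a difference of two nondecreasing ones
    (by total variation); their Lebesgue-Stieltjes measures are dominated by
    the Lebesgue measure, so Radon-Nikodym and Lebesgue differentiation give
    the almost everywhere derivative and the fundamental theorem of calculus. *)

(** * Absolute continuity *)

Section absolute_continuity.
Context {R : realType}.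
Implicit Types (u v e d : R) (f g : R -> R) (L : seq (R * R)).

Definition itv_in u v (x : R * R) := [&& u <= x.1, x.1 <= x.2 & x.2 <= v].

(** The comparisons are large, so that consecutive pieces of a partition, which share an endpoint,
    count as separated. *)
Definition itv_sep (x y : R * R) := (x.2 <= y.1) || (y.2 <= x.1).

(** Absolute continuity on [[u, v]], with lists of non-overlapping intervals
    instead of indexed families. *)
Definition abs_cont u v f := forall e, 0 < e -> exists2 d, 0 < d &
  forall L, all (itv_in u v) L -> pairwise itv_sep L ->
    \sum_(x <- L) (x.2 - x.1) < d -> \sum_(x <- L) `|f x.2 - f x.1| < e.

Lemma itv_sepC x y : itv_sep x y = itv_sep y x.
Proof. by rewrite /itv_sep orbC. Qed.

Lemma absolutely_continuous_on_abs_cont u v f :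
  absolutely_continuous_on u v f -> abs_cont u v f.
Proof.
move=> acf e e0; have [d d0 H] := acf e e0; exists d => // L /allP Lin Lsep Ld.
have nthL i : (i < size L)%N -> nth (u, u) L i \in L by exact: mem_nth.
pose p i := (nth (u, u) L i).1; pose q i := (nth (u, u) L i).2.
have := H (size L) p q; rewrite (big_nth (u, u)) big_mkord; apply.
- by move=> i /nthL/Lin /and3P[].
- apply/trivIsetP => i j iL jL ij.
  wlog: i j iL jL ij / (i < j)%N.
    move=> wl; move: (ij); rewrite neq_ltn => /orP[/wl|/wl]; first exact.
    by rewrite setIC; apply => //; rewrite eq_sym.
  move=> ltij; have := (pairwiseP (u, u)) Lsep i j iL jL ltij.
  rewrite -subset0 => /orP[h|h] x []/=; rewrite !in_itv/= => /andP[a1 a2] /andP[a3 a4].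
    by have := lt_trans a2 (le_lt_trans h a3); rewrite ltxx.
  by have := lt_trans a4 (le_lt_trans h a1); rewrite ltxx.
- by move: Ld; rewrite (big_nth (u, u)) big_mkord.
Qed.

Lemma lipschitz_abs_cont u v f (k : R) :
  (forall x y, u <= x -> x <= y -> y <= v -> `|f y - f x| <= k * (y - x)) ->
  abs_cont u v f.
Proof.
(* The sign of [k] is unknown; [|k| + 1] is a strictly positive Lipschitz constant by which [e] can
   be divided. *)
move=> lf e e0; have k1 : 0 < `|k| + 1 by rewrite ltr_wpDl.
exists (e / (`|k| + 1)); first by rewrite divr_gt0.
move=> L /allP Lin _; rewrite ltr_pdivlMr// => Ld; apply: le_lt_trans Ld.
rewrite mulrC mulr_sumr big_seq [leRHS]big_seq; apply: ler_sum => x /Lin/and3P[ux xx xv].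
apply: le_trans (lf _ _ ux xx xv) _; apply: ler_wpM2r; first by rewrite subr_ge0.
by apply: le_trans (ler_norm _) _; rewrite lerDl.
Qed.

Lemma abs_contD u v f g : abs_cont u v f -> abs_cont u v g ->
  abs_cont u v (fun x => f x + g x).
Proof.
move=> acf acg e e0; have e2 : 0 < e / 2 by rewrite divr_gt0.
have [d d0 Hf] := acf _ e2; have [d' d'0 Hg] := acg _ e2.
exists (Num.min d d'); first by rewrite lt_min d0.
move=> L Lin Ls; rewrite lt_min => /andP[Ld Ld'].
rewrite (splitr e); apply: le_lt_trans (ltrD (Hf _ Lin Ls Ld) (Hg _ Lin Ls Ld')).
rewrite -big_split/=; apply: ler_sum => x _.
by rewrite opprD addrACA; exact: ler_normD.
Qed.

Lemma abs_contZ u v f k : abs_cont u v f -> abs_cont u v (fun x => k * f x).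
Proof.
move=> acf e e0; have k1 : 0 < `|k| + 1 by rewrite ltr_wpDl.
have [d d0 Hf] := acf _ (divr_gt0 e0 k1); exists d => // L Lin Ls Ld.
have := Hf _ Lin Ls Ld; rewrite ltr_pdivlMr//; apply: le_lt_trans.
rewrite mulrC mulr_sumr; apply: ler_sum => x _; rewrite -mulrBr normrM.
by apply: ler_wpM2r => //; rewrite lerDl.
Qed.

Lemma abs_cont_dist u v f : abs_cont u v f -> forall e, 0 < e ->
  exists2 d, 0 < d & forall x y, u <= x -> x <= y -> y <= v -> y - x < d ->
    `|f y - f x| < e.
Proof.
move=> acf e e0; have [d d0 Hf] := acf _ e0; exists d => // x y ux xy yv yxd.
by have := Hf [:: (x, y)]; rewrite !big_seq1 /= /itv_in/= ux xy yv; exact.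
Qed.

(** Walk from [u] in steps of length [d / 2], strictly below the modulus [d]: each step changes [f]
    by less than 1, and the number of steps needed to reach [v] is bounded by the Archimedean
    property. *)
Lemma abs_cont_bounded u v f : abs_cont u v f ->
  exists2 k, 0 < k & forall x, u <= x -> x <= v -> `|f x| <= k.
Proof.
move=> acf; have [d d0 Hd] := abs_cont_dist acf ltr01.
have d2 : 0 < d / 2 by rewrite divr_gt0.
have Hn n : forall x, u <= x -> x <= v -> x - u <= n%:R * (d / 2) ->
    `|f x| <= `|f u| + n%:R.
  elim: n => [x ux _|n IH x ux xv].
    rewrite mul0r subr_le0 => xu; rewrite (@le_anti _ _ u x) ?lexx ?addr0//.
    by rewrite ux xu.
  have step y : u <= y -> y <= x -> x - y <= d / 2 -> `|f x| <= `|f y| + 1.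
    move=> uy yx xyd; rewrite -[f x](subrK (f y)) addrC.
    rewrite (le_trans (ler_normD _ _))// lerD2l ltW// Hd//.
    by rewrite (le_lt_trans xyd)// ltr_pdivrMr// ltr_pMr// ltr1n.
  have [xd _|dx] := leP (x - u) (d / 2).
    by rewrite (le_trans (step _ (lexx _) ux xd))// lerD2l ler1n.
  rewrite -natr1 mulrDl mul1r => xn.
  have uy : u <= x - d / 2 by lra.
  have yx : x - d / 2 <= x by lra.
  have := IH _ uy (le_trans yx xv) ltac:(lra).
  have := step _ uy yx ltac:(lra); lra.
exists (`|f u| + (Num.bound ((v - u) / (d / 2)))%:R + 1).
  by rewrite ltr_wpDl// addr_ge0.
move=> x ux xv; apply: (@le_trans _ _ (`|f u| + (Num.bound ((v - u) / (d / 2)))%:R)).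
  apply: Hn => //; rewrite -ler_pdivrMr//.
  apply: (@le_trans _ _ ((v - u) / (d / 2))).
    by rewrite ler_pM2r ?invr_gt0// lerD2r.
  apply/ltW/archi_boundP; apply: divr_ge0; last exact: ltW.
  by rewrite subr_ge0 (le_trans ux xv).
by rewrite lerDl.
Qed.

Lemma abs_contM u v f g : abs_cont u v f -> abs_cont u v g ->
  abs_cont u v (fun x => f x * g x).
Proof.
move=> acf acg e e0.
have [kf kf0 Hkf] := abs_cont_bounded acf; have [kg kg0 Hkg] := abs_cont_bounded acg.
have ef : 0 < e / 2 / kg by rewrite !divr_gt0.
have eg : 0 < e / 2 / kf by rewrite !divr_gt0.
have [d d0 Hf] := acf _ ef; have [d' d'0 Hg] := acg _ eg.
exists (Num.min d d'); first by rewrite lt_min d0.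
move=> L Lin Ls; rewrite lt_min => /andP[Ld Ld'].
have := Hf _ Lin Ls Ld; rewrite ltr_pdivlMr// => hf.
have := Hg _ Lin Ls Ld'; rewrite ltr_pdivlMr// => hg.
rewrite (splitr e); apply: le_lt_trans (ltrD hf hg).
rewrite !mulr_suml -big_split/= big_seq [leRHS]big_seq; apply: ler_sum => x xL.
have /and3P[ux xx xv] := allP Lin _ xL.
(* Each increment is multiplied by a factor bounded by [kg] or [kf], which explains the tolerances
   [e / 2 / kg] and [e / 2 / kf]. *)
have -> : f x.2 * g x.2 - f x.1 * g x.1 =
  (f x.2 - f x.1) * g x.2 + (g x.2 - g x.1) * f x.1 by ring.
apply: le_trans (ler_normD _ _) _; rewrite !normrM.
by apply: lerD; apply: ler_wpM2l => //; [apply: Hkg|apply: Hkf] => //;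
  [exact: le_trans xx|exact: le_trans xv].
Qed.

Lemma abs_contW u v x y f : u <= x -> y <= v -> abs_cont u v f -> abs_cont x y f.
Proof.
move=> ux yv acf e e0; have [d d0 H] := acf e e0; exists d => // L Lin.
apply: H; apply: sub_all Lin => z /and3P[xz zz zy].
by rewrite /itv_in (le_trans ux xz) zz (le_trans zy yv).
Qed.

(** Pairing consecutive points turns a partition into a list of separated intervals, to which
    [abs_cont] applies, and its variation into a sum over that list. *)
Lemma itv_partition_zip x y s : itv_partition x y s ->
  [/\ all (itv_in x y) (zip (x :: s) s), pairwise itv_sep (zip (x :: s) s),
     \sum_(z <- zip (x :: s) s) (z.2 - z.1) = y - x &
     forall f, variation x y f s = \sum_(z <- zip (x :: s) s) `|f z.2 - f z.1| ].
Proof.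
elim: s x => [x|c s IH x] /[dup] xys.
  move/itv_partition_nil => ->; split=> //=; rewrite ?big_nil ?subrr//.
  by move=> f; rewrite variation_nil big_nil.
move=> /[dup] /itv_partition_cons /[dup] cys /IH[a1 a2 a3 a4].
move=> [/= /andP[xc _] _]; have cy := itv_partition_le cys.
split.
- apply/andP; split; first by rewrite /itv_in/= lexx (ltW xc) cy.
  apply: sub_all a1 => z /and3P[cz zz zy].
  by rewrite /itv_in zz zy (le_trans (ltW xc) cz).
- rewrite a2 andbT; apply: sub_all a1 => z /and3P[cz zz zy].
  by rewrite /itv_sep/= cz.
- by rewrite big_cons a3/=; ring.
- move=> f; rewrite big_cons/= -a4.
  rewrite -[c :: s]cat1s (@variation_cat _ c)//; last 2 first.
  + exact: ltW.
  + exact: itv_partition1.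
  by rewrite /variation/= big_nat1.
Qed.

(** Induction on [L1]: the first interval is cut by an arbitrary partition, whose pieces join [L2],
    and the supremum over partitions is taken afterwards. [L2] thus collects the intervals already
    cut. The supremum weakens the strict bound to a large one. *)
Lemma abs_cont_sum_total_variation u v f e d : 0 < e ->
  (forall L, all (itv_in u v) L -> pairwise itv_sep L ->
    \sum_(x <- L) (x.2 - x.1) < d -> \sum_(x <- L) `|f x.2 - f x.1| < e) ->
  forall L1 L2, all (itv_in u v) (L1 ++ L2) -> pairwise itv_sep (L1 ++ L2) ->
    \sum_(x <- L1 ++ L2) (x.2 - x.1) < d ->
  (\sum_(x <- L1) total_variation x.1 x.2 f + (\sum_(x <- L2) `|f x.2 - f x.1|)%:E
    <= e%:E)%E.
Proof.
move=> e0 H; elim=> [L2 Lin Ls Ld|x L1 IH L2].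
  by rewrite big_nil add0e lee_fin ltW// H.
rewrite cat_cons [all _ _]/= => /andP[/and3P[ux xx xv] Lin].
rewrite [pairwise _ _]/= => /andP[xL Ls]; rewrite big_cons => Ld.
have key s : itv_partition x.1 x.2 s ->
    ((variation x.1 x.2 f s)%:E + (\sum_(x <- L1) total_variation x.1 x.2 f +
     (\sum_(x <- L2) `|f x.2 - f x.1|)%:E) <= e%:E)%E.
  move=> xs; have [z1 z2 z3 z4] := itv_partition_zip xs.
  rewrite z4 addeCA -EFinD -big_cat/=; apply: IH.
  - rewrite !all_cat in Lin *; have /andP[-> ->] := Lin; rewrite andbT/=.
    apply: sub_all z1 => z /and3P[cz zz zy].
    by rewrite /itv_in zz (le_trans ux cz) (le_trans zy xv).
  - have zL L : all (itv_sep x) L -> allrel itv_sep (zip (x.1 :: s) s) L.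
      move=> /allP xsL; apply/allrelP => z y zz /xsL.
      have /and3P[xz zz' zx] := allP z1 _ zz.
      by rewrite /itv_sep => /orP[h|h]; rewrite ?(le_trans zx h)// (le_trans h xz) orbT.
    move: xL Ls; rewrite all_cat !pairwise_cat => /andP[xL1 xL2] /and3P[s12 s1 s2].
    rewrite s1 s2 z2 zL// allrel_catr s12 !andbT/=.
    apply/allrelP => y z yL zs; rewrite itv_sepC.
    by have /allrelP := zL _ xL1; exact.
  - by move: Ld; rewrite !big_cat/= z3 addrCA.
rewrite big_cons -addeA.
set S := (\sum_(x <- L1) _ + _)%E in key *.
have S0 : (0 <= S)%E.
  rewrite /S adde_ge0 ?lee_fin ?sumr_ge0// big_seq sume_ge0// => y yL.
  apply: total_variation_ge0; have := allP Lin y.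
  by rewrite mem_cat yL => /(_ isT)/and3P[].
(* The induction hypothesis with the same [L2] bounds [S] by [e]; being finite, [S] can be moved to
   the other side before the supremum is taken. *)
have Sfin : S \is a fin_num.
  rewrite ge0_fin_numE// (le_lt_trans _ (ltry e))//; apply: IH => //.
  apply: le_lt_trans Ld; rewrite lerDr subr_ge0//.
rewrite -leeBrDr//; apply: ge_ereal_sup => _ [_ [s xs <-] <-].
by rewrite leeBrDr//; exact: key.
Qed.

(** The variation is at most 1 on every interval of length at most [d / 2], and total variation is
    additive over finitely many such intervals. *)
Lemma abs_cont_total_variation_fin u v f : abs_cont u v f ->
  forall x y, u <= x -> x <= y -> y <= v -> total_variation x y f \is a fin_num.
Proof.
move=> acf; have [d d0 Hd] := acf _ ltr01.
have d2 : 0 < d / 2 by rewrite divr_gt0.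
have small x y : u <= x -> x <= y -> y <= v -> y - x <= d / 2 ->
    total_variation x y f \is a fin_num.
  move=> ux xy yv yxd; rewrite ge0_fin_numE ?total_variation_ge0//.
  apply: (@le_lt_trans _ _ 1%E); last exact: ltry.
  have := @abs_cont_sum_total_variation u v f _ _ ltr01 Hd [:: (x, y)] [::].
  rewrite cats0 big_nil adde0 !big_seq1/= /itv_in/= ux xy yv; apply => //.
  by rewrite (le_lt_trans yxd)// ltr_pdivrMr// ltr_pMr// ltr1n.
have Hn n : forall x y, u <= x -> x <= y -> y <= v -> y - x <= n%:R * (d / 2) ->
    total_variation x y f \is a fin_num.
  elim: n => [x y ux xy yv|n IH x y ux xy yv].
    by rewrite mul0r => h; apply: small => //; exact: le_trans h (ltW d2).
  have [yxd _|dx] := leP (y - x) (d / 2); first exact: small.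
  rewrite -natr1 mulrDl mul1r => yn.
  have xz : x <= y - d / 2 by lra.
  have zy : y - d / 2 <= y by lra.
  rewrite (total_variationD _ xz zy) fin_numD; apply/andP; split.
    by apply: IH => //; [exact: le_trans yv|lra].
  by apply: small => //; [exact: le_trans xz|lra].
move=> x y ux xy yv; apply: (Hn (Num.bound ((y - x) / (d / 2)))) => //.
rewrite -ler_pdivrMr// ltW// archi_boundP// divr_ge0 ?(ltW d2)// subr_ge0//.
Qed.

(** Jordan decomposition [f = T - (T - f)] with [T] the variation function; [T] inherits absolute
    continuity from the bound on sums of total variations. *)
Lemma abs_cont_jordan u v f : abs_cont u v f ->
  exists f1 f2 : R -> R, [/\ abs_cont u v f1, abs_cont u v f2,
    {in `[u, v] &, nondecreasing f1}, {in `[u, v] &, nondecreasing f2} &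
    forall x, f x = f1 x - f2 x].
Proof.
move=> acf; have TVfin := abs_cont_total_variation_fin acf.
pose T x := fine (total_variation u x f).
have TE x y : u <= x -> x <= y -> y <= v ->
    (T y - T x)%:E = total_variation x y f.
  move=> ux xy yv; rewrite /T EFinB !fineK ?TVfin ?(le_trans ux xy) ?(le_trans xy yv)//.
  rewrite (total_variationD f ux xy) addeAC subee ?add0e// TVfin//.
  exact: le_trans yv.
have acT : abs_cont u v T.
  (* That bound is a large inequality; halving [e] restores strictness. *)
  move=> e e0; have e2 : 0 < e / 2 by rewrite divr_gt0.
  have [d d0 Hd] := acf _ e2; exists d => // L Lin Ls Ld.
  have := @abs_cont_sum_total_variation u v f _ _ e2 Hd L [::].
  rewrite !cats0 big_nil adde0 => /(_ Lin Ls Ld) le2.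
  apply: (@le_lt_trans _ _ (e / 2)); last by rewrite ltr_pdivrMr// ltr_pMr// ltr1n.
  rewrite -lee_fin; apply: le_trans le2; rewrite -sumEFin big_seq [leRHS]big_seq.
  apply: lee_sum => x /(allP Lin)/and3P[ux xx xv].
  rewrite -TE// ger0_norm// -lee_fin TE// total_variation_ge0//.
exists T, (fun x => T x + (-1) * f x); split => //.
- by apply: abs_contD => //; exact: abs_contZ.
- move=> x y; rewrite !in_itv/= => /andP[ux _] /andP[_ yv] xy.
  by rewrite -subr_ge0 -lee_fin TE// total_variation_ge0.
- move=> x y; rewrite !in_itv/= => /andP[ux _] /andP[_ yv] xy.
  suff : f y - f x <= T y - T x by lra.
  rewrite -lee_fin TE//; apply: le_trans (total_variation_ge f xy).
  by rewrite lee_fin ler_norm.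
- by move=> x; ring.
Qed.

End absolute_continuity.

(** * Densities of nondecreasing absolutely continuous functions *)

Section monotone_density.
Context {R : realType}.
Implicit Types (u v : R).
Local Notation leb := (@lebesgue_measure R).

(** For [u <= v] this is the projection onto the segment from [u] to [v]. Composing with it extends
    a function by constants to the whole line; the projection is monotone and 1-Lipschitz, so
    monotonicity and moduli of continuity survive. *)
Definition clip u v (x : R) := Num.max u (Num.min x v).

Lemma clip_in u v x : u <= v -> u <= clip u v x <= v.
Proof. by move=> uv; rewrite le_max lexx ge_max uv ge_min lexx orbT. Qed.

Lemma clip_id u v x : u <= x -> x <= v -> clip u v x = x.
Proof. by move=> ux xv; rewrite /clip min_l// max_r. Qed.

Lemma clip_homo u v x y : x <= y -> clip u v x <= clip u v y.
Proof.
move=> xy; rewrite /clip ge_max le_max lexx/= le_max; apply/orP; right.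
by rewrite le_min !ge_min xy lexx orbT.
Qed.

Lemma clip_dist u v x y : x <= y -> clip u v y - clip u v x <= y - x.
Proof.
move=> xy; rewrite /clip.
case: (leP x v) => xv; case: (leP y v) => yv; rewrite ?(maxElt, minElt).
- case: ltP => h1; case: ltP => h2; lra.
- case: ltP => h1; case: ltP => h2; lra.
- lra.
- rewrite subrr; lra.
Qed.

Section stieltjes.
Variables (u v : R) (F : R -> R).
Hypotheses (uv : u <= v) (acF : abs_cont u v F)
  (ndF : {in `[u, v] &, nondecreasing F}).

Let G x := F (clip u v x).

Let G_nd : nondecreasing G.
Proof.
move=> x y xy; apply: ndF; rewrite ?in_itv/= ?clip_in//; exact: clip_homo.
Qed.

Let G_rc : right_continuous G.
Proof.
move=> x; apply/cvgrPdist_lt => e e0.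
have [d d0 Hd] := abs_cont_dist acF e0.
near=> y; have xy : x <= y by near: y; exact: nbhs_right_ge.
rewrite distrC; have /andP[ux xv] := clip_in x uv; have /andP[uy yv] := clip_in y uv.
apply: Hd => //; first exact: clip_homo.
apply: le_lt_trans (clip_dist _ _ xy) _; rewrite ltrBlDl.
by near: y; apply: nbhs_right_lt; rewrite ltrDl.
Unshelve. all: by end_near. Qed.

HB.instance Definition _ := isCumulative.Build R _ R G G_nd G_rc.

Let m : {measure set (measurableTypeR R) -> \bar R} := lebesgue_stieltjes_measure G.

Let m_itvoc a b : a <= b -> m `]a, b]%classic = (G b - G a)%:E.
Proof.
move=> ab.
rewrite /m/= /lebesgue_stieltjes_measure/= /measure_extension/=.
rewrite measurable_mu_extE/=; last exact: is_ocitv.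
exact: wlength_itv_bnd.
Qed.

(** An open set is the disjoint union of countably many open intervals; absolute continuity bounds
    the Stieltjes mass of any finite number of them, hence of the whole series. Confinement to a
    bounded interval gives these components real endpoints. *)
Let open_small (e : R) : 0 < e -> exists2 d : R, 0 < d & forall U : set R,
  open U -> U `<=` `](u - 1), (v + 1)[ -> (leb U < d%:E)%E -> (m U <= e%:E)%E.
Proof.
move=> e0; have [d d0 Hd] := acF e0; exists d => // U oU Ub Ud.
pose I := open_disjoint_itv oU.
have Uo n : open (I n) by exact: open_disjoint_itv_open.
have UE : U = \bigcup_n I n by exact: open_disjoint_itv_bigcup.
have mI n : measurable (I n) by exact: open_measurable.
have tI : trivIset setT I by exact: open_disjoint_itv_trivIset.
(* The dummy pair [(u, u)] is separated from every subinterval of [[u, v]]. *)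
have /choice[ab abP] : forall n, exists ab : R * R,
    (I n = set0 /\ ab = (u, u)) \/
    (ab.1 < ab.2 /\ I n = `]ab.1, ab.2[%classic).
  move=> n.
  have [In0|/set0P[x Inx]] := eqVneq (I n) set0; first by exists (u, u); left.
  have InU : I n `<=` `](u - 1), (v + 1)[.
    by apply: subset_trans Ub; rewrite UE; exact: bigcup_sup.
  have InE : I n = [set r | inf (I n) < r < sup (I n)].
    rewrite -[LHS](interior_id _).1//; apply: interval_bounded_interior.
    - exact: open_disjoint_itv_is_interval.
    - by exists (u - 1) => y /InU; rewrite /= in_itv/= => /andP[/ltW].
    - by exists (v + 1) => y /InU; rewrite /= in_itv/= => /andP[_ /ltW].
  exists (inf (I n), sup (I n)); right => /=; split.
    by move: Inx; rewrite {1}InE/= => /andP[]; exact: lt_trans.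
  by rewrite {1}InE; apply/seteqP; split => r; rewrite /= in_itv.
(* [acF] only handles subintervals of the segment from [u] to [v]. Clipping the endpoints does not
   change the increments of [G], and lengths can only decrease. *)
pose P n := (clip u v (ab n).1, clip u v (ab n).2).
have ab_le n : (ab n).1 <= (ab n).2.
  by case: (abP n) => [[_ ->]//|[/ltW]].
have lebI n : leb (I n) = ((ab n).2 - (ab n).1)%:E.
  case: (abP n) => [[-> ->]|[lt ->]]; first by rewrite measure0/= subrr.
  by rewrite lebesgue_measure_itv/= lte_fin lt.
have mIle n : (m (I n) <= (G (ab n).2 - G (ab n).1)%:E)%E.
  have sub : I n `<=` `](ab n).1, (ab n).2].
    case: (abP n) => [[-> _]|[_ ->]]; first exact: sub0set.
    by apply: subset_itvl; rewrite bnd_simp.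
  rewrite -m_itvoc//; apply: (le_measure m _ _ sub); rewrite inE; first exact: mI.
  exact: measurable_itv.
rewrite UE measure_semi_bigcup//; last by rewrite -UE; exact: open_measurable.
apply: lime_le; first by apply: is_cvg_nneseries => n _ _; exact: measure_ge0.
apply: nearW => n; apply: (@le_trans _ _ (\sum_(0 <= i < n) (G (ab i).2 - G (ab i).1)%:E)%E).
  by apply: lee_sum => i _; exact: mIle.
rewrite sumEFin lee_fin; apply: ltW.
have := Hd (mkseq P n); rewrite /mkseq !big_map.
have -> : \sum_(i <- iota 0 n) `|F (P i).2 - F (P i).1| =
    \sum_(0 <= i < n) (G (ab i).2 - G (ab i).1).
  rewrite /index_iota subn0; apply: eq_bigr => i _; rewrite ger0_norm// subr_ge0.
  exact: G_nd.
apply.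
- apply/allP => _ /mapP[i _ ->]; rewrite /itv_in/= clip_homo//.
  by have /andP[-> _] := clip_in (ab i).1 uv; have /andP[_ ->] := clip_in (ab i).2 uv.
- apply/(pairwiseP (u, u)) => i j; rewrite !inE size_map size_iota => ni nj ij.
  rewrite !(nth_map 0%N) ?size_iota// !nth_iota// !add0n /itv_sep/=.
  have cu x : u <= clip u v x by have /andP[] := clip_in x uv.
  case: (abP i) => [[_ ->]|[lti Ii]]; first by rewrite /= (clip_id (lexx u) uv) cu.
  case: (abP j) => [[_ ->]|[ltj Ij]].
    by rewrite /= (clip_id (lexx u) uv) cu orbT.
  have [h|h] := leP (ab i).2 (ab j).1; first by apply/orP; left; exact: clip_homo.
  have [h'|h'] := leP (ab j).2 (ab i).1; first by apply/orP; right; exact: clip_homo.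
  (* Two overlapping components would share the midpoint of their intersection. *)
  exfalso; have := tI i j Logic.I Logic.I; rewrite Ii Ij => tIij.
  suff /tIij eij : `](ab i).1, (ab i).2[ `&` `](ab j).1, (ab j).2[ !=set0.
    by move: ij; rewrite eij ltnn.
  exists ((Num.max (ab i).1 (ab j).1 + Num.min (ab i).2 (ab j).2) / 2).
  rewrite /= !in_itv/=.
  case: (leP (ab i).1 (ab j).1) => ?; case: (leP (ab i).2 (ab j).2) => ?;
    by split; apply/andP; split; lra.
- rewrite -lte_fin; apply: le_lt_trans Ud.
  rewrite UE measure_semi_bigcup//; last by rewrite -UE; exact: open_measurable.
  apply: le_trans; last by apply: (@nneseries_lim_ge _ _ xpredT 0%N n).
  rewrite /index_iota subn0 -sumEFin; apply: lee_sum => i _.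
  apply: (@le_trans _ _ ((ab i).2 - (ab i).1)%:E); last by rewrite -lebI.
  by rewrite lee_fin clip_dist.
Qed.

Let moo : (m `]u, v]%classic < +oo)%E.
Proof. by rewrite m_itvoc// ltry. Qed.

Let mu : {finite_measure set (measurableTypeR R) -> \bar R} :=
  @mfrestr _ (measurableTypeR R) R _ m (measurable_itv `]u, v]) moo.

(** By outer regularity a Lebesgue-null set lies in open sets of arbitrarily small Lebesgue measure,
    which have small Stieltjes measure by [open_small]. *)
Let mu_dominates : mu `<< leb.
Proof.
move=> A0s A0n A mA AA0; have A0 := A0n _ mA AA0.
rewrite /mu /mfrestr /mrestr.
have mA' : measurable (A `&` `]u, v]) by exact: measurableI.
have A'0 : leb (A `&` `]u, v]) = 0%E.
  by apply: subset_measure0 A0 => //; exact: subIsetl.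
apply/eqP; rewrite eq_le measure_ge0 andbT; apply/lee_addgt0Pr => e e0.
rewrite add0e; have [d d0 Hd] := open_small e0.
have [U [oU AU Ud]] : exists U : set R, [/\ open U, A `&` `]u, v] `<=` U &
    (leb (U `\` (A `&` `]u, v])) < d%:E)%E].
  have A'fin : (leb (A `&` `]u, v]) < +oo)%E by rewrite A'0.
  exact: lebesgue_regularity_outer.
have mU := open_measurable oU.
have mW : measurable (U `&` `](u - 1), (v + 1)[) by exact: measurableI.
apply: (@le_trans _ _ (m (U `&` `](u - 1), (v + 1)[))).
  apply: le_measure; rewrite ?inE// => x Ax; split; first exact: AU.
  by move: Ax => [_] /=; rewrite !in_itv/= => /andP[ux xv]; apply/andP; split; lra.
apply: Hd.
- by apply: openI => //; exact: interval_open.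
- exact: subIsetr.
- apply: (@le_lt_trans _ _ (leb U)).
    by apply: le_measure; rewrite ?inE//; exact: subIsetl.
  apply: le_lt_trans Ud; rewrite -[X in (leb X <= _)%E](setDUK AU).
  apply: (@le_trans _ _ (leb (A `&` `]u, v]) + leb (U `\` (A `&` `]u, v])))%E).
    by apply: measureU2 => //; exact: measurableD.
  by rewrite A'0 add0e.
Qed.

Lemma nondecreasing_abs_cont_density : exists2 w : R -> R,
  leb.-integrable setT (EFin \o w) &
  forall x, u <= x -> x <= v ->
    (\int[leb]_(t in `]u, x]) (w t)%:E = (F x - F u)%:E)%E.
Proof.
have dom : charge_of_finite_measure mu `<< leb by exact: mu_dominates.
(* The Radon-Nikodym derivative is finite everywhere, so [fine] gives a real density without
   loss. *)
have fin := Radon_Nikodym_fin_num _ dom.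
pose w := Radon_Nikodym (charge_of_finite_measure mu) leb.
have wE : EFin \o (fine \o w) = w by apply/funext => x /=; rewrite fineK// fin.
exists (fine \o w); first by rewrite wE; exact: Radon_Nikodym_integrable.
move=> x ux xv.
transitivity (\int[leb]_(t in `]u, x]) w t)%E.
  by apply: eq_integral => t _; rewrite -[in RHS]wE.
rewrite -Radon_Nikodym_integral//= /charge_of_finite_measure /mu /mfrestr /mrestr.
have -> : `]u, x] `&` `]u, v] = `]u, x]%classic.
  by apply: setIidl; apply: subset_itvl; rewrite bnd_simp.
by rewrite m_itvoc// /G !clip_id.
Qed.

End stieltjes.
End monotone_density.

(** * Integration of absolutely continuous functions and a Hardy inequality *)

Section integral_comparison.
Context d (T : measurableType d) (R : realType) (mu : {measure set T -> \bar R}).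
Local Open Scope ereal_scope.

(** Unlike in [ge0_le_integral], the functions need not be measurable: the
    integral of a nonnegative function is a supremum over simple minorants. *)
Lemma ge0_le_integral_nonmeasurable (D : set T) (f g : T -> \bar R) :
  (forall x, D x -> 0 <= f x) -> (forall x, D x -> f x <= g x) ->
  \int[mu]_(x in D) f x <= \int[mu]_(x in D) g x.
Proof.
move=> f0 fg; have g0 x : D x -> 0 <= g x by move=> Dx; exact: le_trans (f0 _ Dx) (fg _ Dx).
rewrite (ge0_integralE _ f0) (ge0_integralE _ g0); apply: ereal_sup_le.
move=> _ [k kf <-]; exists k => // x; apply: le_trans (kf x) _.
by rewrite !patchE; case: ifPn => // /set_mem; exact: fg.
Qed.

(** The maximum of [f] and [g] dominates [f] everywhere and equals [g] almost everywhere. It is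
    integrable unless the integral of [g] is infinite, in which case the bound is trivial. *)
Lemma ae_le_integral (D : set T) (f g : T -> \bar R) : measurable D ->
  mu.-integrable D f -> measurable_fun D g -> (forall x, D x -> 0 <= g x) ->
  {ae mu, forall x, D x -> f x <= g x} ->
  \int[mu]_(x in D) f x <= \int[mu]_(x in D) g x.
Proof.
move=> mD intf mg g0 fg; have mf := measurable_int _ intf.
have mfg : measurable_fun D (fun x => maxe (f x) (g x)) by exact: measurable_maxe.
have fgg x : D x -> 0 <= maxe (f x) (g x).
  by move=> Dx; rewrite le_max g0 ?orbT.
have fgE : \int[mu]_(x in D) maxe (f x) (g x) = \int[mu]_(x in D) g x.
  apply: ge0_ae_eq_integral => //.
  apply: filterS fg => x fgx Dx; exact/max_idPr/fgx.
have [->|goo] := eqVneq (\int[mu]_(x in D) g x) +oo; first exact: leey.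
rewrite -fgE; apply: le_integral => //.
  apply/integrableP; split=> //; under eq_integral.
    move=> x /[!inE] Dx; rewrite gee0_abs ?fgg//; over.
  by rewrite fgE ltey.
by move=> x _; rewrite le_max lexx.
Qed.

End integral_comparison.

(** * Almost everywhere derivatives, primitives and the Hardy inequality *)

Section abs_cont_integral.
Context {R : realType}.
Implicit Types (u v p q : R) (f w : R -> R).
Local Notation leb := (@lebesgue_measure R).

Lemma abs_cont_density u v f : u <= v -> abs_cont u v f ->
  exists2 w : R -> R, leb.-integrable setT (EFin \o w) &
  forall x, u <= x -> x <= v ->
    (\int[leb]_(t in `]u, x]) (w t)%:E = (f x - f u)%:E)%E.
Proof.
move=> uv acf; have [f1 [f2 [ac1 ac2 nd1 nd2 fE]]] := abs_cont_jordan acf.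
have [w1 int1 w1E] := nondecreasing_abs_cont_density uv ac1 nd1.
have [w2 int2 w2E] := nondecreasing_abs_cont_density uv ac2 nd2.
exists (fun x => w1 x - w2 x).
  rewrite (_ : EFin \o _ = (EFin \o w1) \- (EFin \o w2))%E//.
  exact: integrableB.
move=> x ux xv; under eq_integral do rewrite EFinB.
rewrite integralB//; try by [exact: integrableS int1|exact: integrableS int2].
rewrite w1E// w2E// -EFinB !fE; congr (_%:E); ring.
Qed.

(** Lebesgue differentiation applies to the primitive of [w] from [u], which coincides with
    [f - f u] near every interior point. *)
Lemma abs_cont_derivable_ae u v f w : leb.-integrable setT (EFin \o w) ->
  (forall x, u <= x -> x <= v ->
    (\int[leb]_(t in `]u, x]) (w t)%:E = (f x - f u)%:E)%E) ->
  {ae leb, forall x, x \in `]u, v[ -> derivable f x 1 /\ derive1 f x = w x}.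
Proof.
move=> intw wE.
have locw : locally_integrable setT w.
  by apply: open_integrable_locally => //; exact: openT.
have intwy y : leb.-integrable [set` Interval (BRight u) (BRight y)] (EFin \o w).
  exact: integrableS intw.
have := FTC1 intwy locw.
apply: filterS; first exact: (ae_filter_ringOfSetsType leb).
move=> x Fx /[dup] xuv; rewrite in_itv/= => /andP[ux xv].
have [|dF F'] := Fx; first exact: ux.
pose F y := \int[leb]_(t in `]u, y]) w t.
have nF : {near x, F =1 (fun y => f y - f u)}.
  near=> y; have : y \in `]u, v[ by near: y; exact: near_in_itvoo.
  by rewrite in_itv/= => /andP[uy yv]; rewrite /F /Rintegral wE ?ltW.
have nf : {near x, (fun y => F y + f u) =1 f}.
  by apply: filterS nF => y /= ->; rewrite subrK.
have FD : is_derive x 1 F (w x) := DeriveDef dF (etrans (esym (derive1E F x)) F').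
clear dF F' Fx; move: F nF nf FD => F _ nf FD.
have FuD : is_derive x 1 (fun y => F y + f u) (w x + 0).
  exact: (is_deriveD FD (is_derive_cst (f u) x 1)).
split; first exact: near_eq_derivable nf (@ex_derive _ _ _ _ _ _ _ FuD).
by rewrite derive1E -(near_eq_derive _ nf) (@derive_val _ _ _ _ _ _ _ FuD) addr0.
Unshelve. all: by end_near. Qed.

Lemma abs_contV p q f (r : R) : 0 < r -> (forall x, p <= x -> x <= q -> r <= f x) ->
  abs_cont p q f -> abs_cont p q (fun x => (f x)^-1).
Proof.
(* Inversion is Lipschitz with constant [1 / r ^+ 2] above [r], hence the tolerance [e * r ^+ 2]. *)
move=> r0 rf acf e e0; have [|d d0 Hd] := acf (e * r ^+ 2).
  by rewrite mulr_gt0// exprn_gt0.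
exists d => // L Lin Ls Ld; rewrite -(ltr_pM2r (exprn_gt0 2 r0)).
apply: le_lt_trans (Hd L Lin Ls Ld).
rewrite mulr_suml big_seq [leRHS]big_seq; apply: ler_sum => x /(allP Lin)/and3P[px xx xq].
have r1 : r <= f x.1 by apply: rf => //; exact: le_trans xq.
have r2 : r <= f x.2 by apply: rf => //; exact: le_trans px xx.
have f1 : 0 < f x.1 by exact: lt_le_trans r1.
have f2 : 0 < f x.2 by exact: lt_le_trans r2.
have -> : (f x.2)^-1 - (f x.1)^-1 = (f x.1 - f x.2) / (f x.1 * f x.2).
  by field; rewrite !gt_eqF.
rewrite normrM distrC normfV (gtr0_norm (mulr_gt0 f1 f2)) -mulrA ler_piMr//.
rewrite mulrC ler_pdivrMr ?mulr_gt0// mul1r expr2.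
by apply: ler_pM => //; exact: ltW.
Qed.

Lemma abs_cont_cst p q (c : R) : abs_cont p q (fun=> c).
Proof.
apply: (@lipschitz_abs_cont _ _ _ _ 0) => x y _ _ _.
by rewrite subrr normr0 mul0r.
Qed.

Section primitive.
Variables (p q : R) (k : R -> R).
Hypothesis ck : forall x, p <= x -> x <= q -> {for x, continuous k}.

Let ck_within : {within `[p, q], continuous k}.
Proof.
apply: continuous_in_subspaceT => x; rewrite inE/= in_itv/= => /andP[px xq].
exact: ck.
Qed.

Lemma continuous_itv_integrable : leb.-integrable `[p, q] (EFin \o k).
Proof.
by apply: continuous_compact_integrable => //; exact: segment_compact.
Qed.

Lemma continuous_itv_bounded : exists2 B : R, 0 <= B &
  forall x, p <= x -> x <= q -> `|k x| <= B.
Proof.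
have [pq|qp] := leP p q; last first.
  exists 0 => // x px xq; by have := lt_le_trans qp (le_trans px xq); rewrite ltxx.
have ck2 : {within `[p, q], continuous (fun x => `|k x|)}.
  apply: continuous_in_subspaceT => x; rewrite inE/= in_itv/= => /andP[px xq].
  by apply: continuous_comp; [exact: ck|exact: norm_continuous].
have [c _ Hc] := EVT_max pq ck2.
by exists `|k c| => // x px xq; apply: Hc; rewrite in_itv/= px.
Qed.

Lemma Rintegral_itvccB x y : p <= x -> x <= y -> y <= q ->
  \int[leb]_(t in `[p, y]) k t - \int[leb]_(t in `[p, x]) k t =
  \int[leb]_(t in `]x, y]) k t.
Proof.
move=> px xy yq; rewrite Rintegral_itvB ?bnd_simp//.
by apply: integrableS continuous_itv_integrable => //; apply: subset_itvl; rewrite bnd_simp.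
Qed.

Lemma primitive_lipschitz : exists B : R, forall x y, p <= x -> x <= y -> y <= q ->
  `|\int[leb]_(t in `[p, y]) k t - \int[leb]_(t in `[p, x]) k t| <= B * (y - x).
Proof.
have [B B0 HB] := continuous_itv_bounded; exists B => x y px xy yq.
have sub : `]x, y] `<=` `[p, q] by apply: subset_itv; rewrite bnd_simp.
have intk : leb.-integrable `]x, y] (EFin \o k).
  exact: integrableS continuous_itv_integrable.
rewrite Rintegral_itvccB//; apply: le_trans (le_normr_Rintegral _ intk) _ => //.
apply: (@le_trans _ _ (\int[leb]_(t in `]x, y]) (cst B) t)).
  apply: le_Rintegral => //.
  - exact: integrable_norm.
  - have intB : leb.-integrable `[x, y] (EFin \o cst B).
      apply: continuous_compact_integrable; first exact: segment_compact.
      by apply: continuous_subspaceT => ?; exact: cst_continuous.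
    by apply: integrableS intB => //; apply: subset_itvr; rewrite bnd_simp.
  - move=> t; rewrite /= in_itv/= => /andP[xt ty].
    by apply: HB; [exact: le_trans (ltW xt)|exact: le_trans yq].
rewrite Rintegral_cst//= lebesgue_measure_itv/= lte_fin.
have [_|_] := ltP x y; first by rewrite -EFinB.
by rewrite mulr0 mulr_ge0// subr_ge0.
Qed.

Lemma primitive_abs_cont : abs_cont p q (fun x => \int[leb]_(t in `[p, x]) k t).
Proof.
by have [B HB] := primitive_lipschitz; exact: lipschitz_abs_cont HB.
Qed.

Lemma primitive_is_derive x : p < x -> x < q ->
  is_derive x 1 (fun x => \int[leb]_(t in `[p, x]) k t : R) (k x).
Proof.
move=> px xq.
have [d1 d2] := continuous_FTC1_closed xq continuous_itv_integrable px (ck (ltW px) (ltW xq)).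
exact: DeriveDef d1 (etrans (esym (derive1E _ _)) d2).
Qed.

End primitive.

(** With [psi = e (1 / (4 rho) + H / (4 K))], the hypotheses give
    [psi' + s psi^2 + h / (4 K) <= 0], and completing the square
    [(w / sqrt s - sqrt s psi (f - c))^2 >= 0] bounds [(psi (f - c)^2)'] by
    [w^2 / s - h (f - c)^2 / (4 K)]; the boundary terms have a sign. *)
Lemma riccati_hardy p q (c e K r : R) (f w rho H s h : R -> R) :
  p <= q -> (e == 1) || (e == -1) -> 0 < K -> 0 < r ->
  abs_cont p q f -> abs_cont p q rho -> abs_cont p q H ->
  (forall x, p <= x -> x <= q -> [/\ r <= rho x, 0 <= H x & rho x * H x <= K]) ->
  (forall x, p < x -> x < q -> [/\ 0 < s x, is_derive x 1 rho (e * s x) &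
    is_derive x 1 H (- e * h x)]) ->
  {ae leb, forall x, x \in `]p, q[ -> derivable f x 1 /\ derive1 f x = w x} ->
  (e = 1 -> f p = c) -> (e = -1 -> f q = c) ->
  leb.-integrable `]p, q] (fun x => (h x * (f x - c) ^+ 2)%:E) ->
  measurable_fun `]p, q] (fun x => w x ^+ 2 / s x) ->
  (forall x, p < x -> x <= q -> 0 <= s x) ->
  (\int[leb]_(x in `]p, q]) (h x * (f x - c) ^+ 2)%:E <=
   (4 * K)%:E * \int[leb]_(x in `]p, q]) (w x ^+ 2 / s x)%:E)%E.
Proof.
move=> pq e1 K0 r0 acf acrho acH rH dd aew fp fq inthf mws s0.
have K4 : 0 < 4 * K by rewrite mulr_gt0.
pose psi x := e * (4^-1 * (rho x)^-1 + (4 * K)^-1 * H x).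
pose G x := psi x * ((f x + - c) * (f x + - c)).
have acG : abs_cont p q G.
  apply: abs_contM.
    apply: abs_contZ; apply: abs_contD; apply: abs_contZ => //.
    by apply: (@abs_contV _ _ _ r) => // x px xq; have [] := rH x px xq.
  by apply: abs_contM; apply: abs_contD => //; exact: abs_cont_cst.
have psi0 x : p <= x -> x <= q -> 0 <= 4^-1 * (rho x)^-1 + (4 * K)^-1 * H x.
  move=> px xq; have [rr Hx _] := rH x px xq.
  by rewrite addr_ge0// mulr_ge0// invr_ge0 ltW// (lt_le_trans r0 rr).
(* At the endpoint selected by [e] the factor [f - c] vanishes; at the other one [G] has the sign of
   [e]. *)
have Gpq : 0 <= G q - G p.
  case/orP: e1 => /eqP e1.
  - rewrite /G fp// subrr !mulr0 subr0 -expr2; apply: mulr_ge0; last exact: sqr_ge0.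
    by rewrite /psi e1 mul1r psi0.
  - rewrite /G fq// subrr !mulr0 sub0r oppr_ge0 -expr2.
    by apply: mulr_le0_ge0; [rewrite /psi e1 mulN1r oppr_le0 psi0|exact: sqr_ge0].
have [wG intwG wGE] := abs_cont_density pq acG.
have aeG := abs_cont_derivable_ae intwG wGE.
have intG : leb.-integrable `]p, q] (EFin \o wG) by exact: integrableS intwG.
rewrite -ge0_integralZl//; last 3 first.
- exact/measurable_EFinP.
- by move=> x; rewrite /= in_itv/= => /andP[px xq]; rewrite lee_fin divr_ge0 ?sqr_ge0 ?s0.
- by rewrite lee_fin ltW.
have intKG : leb.-integrable `]p, q] (fun x => (4 * K)%:E * (wG x)%:E)%E.
  exact: integrableZl.
(* The integral of [4 K wG] is [4 K (G q - G p)], which is nonnegative. Adding it to the left-hand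
   side reduces the claim to an almost everywhere inequality between integrands. *)
apply: (@le_trans _ _ (\int[leb]_(x in `]p, q])
   ((4 * K)%:E * (wG x)%:E + (h x * (f x - c) ^+ 2)%:E)%E)%E).
  rewrite integralD// integralZl// wGE// leeDr// mule_ge0// lee_fin//.
  exact: ltW.
apply: ae_le_integral => //.
- exact: integrableD.
- by apply: measurable_funeM; exact/measurable_EFinP.
- move=> x; rewrite /= in_itv/= => /andP[px xq].
  by rewrite -EFinM lee_fin mulr_ge0 ?(ltW K4)// divr_ge0 ?sqr_ge0 ?s0.
(* Derivatives are controlled on the open interval only; the endpoint [q] is a null set. *)
have aeq : {ae leb, forall x, x != q}.
  exists [set q]; split => //; first exact: lebesgue_measure_set1.
  by move=> x /= /negP; rewrite negbK => /eqP.
have aeF := ae_filter_ringOfSetsType leb.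
have := @filterI _ _ aeF _ _ aew (@filterI _ _ aeF _ _ aeG aeq).
apply: filterS => x [xw [xG xq]]; rewrite /= in_itv/= => /andP[px].
rewrite le_eqVlt (negbTE xq)/= => {}xq.
have xpq : x \in `]p, q[ by rewrite in_itv/= px.
have [df f'w] := xw xpq; have [_ <-] := xG xpq.
have [sx drho dH] := dd x px xq; have [rr Hx rhoH] := rH x (ltW px) (ltW xq).
have rho0 : 0 < rho x by exact: lt_le_trans rr.
have dfx : is_derive x 1 f (w x) by apply: DeriveDef => //; rewrite -derive1E.
have ee : e ^+ 2 = 1 by case/orP: e1 => /eqP ->; rewrite ?sqrrN expr1n.
have rhon0 : rho x != 0 by rewrite gt_eqF.
have dpsi : is_derive x 1 psi
    (e *: (4^-1 *: (- rho x ^- 2 *: (e * s x)) + (4 * K)^-1 *: (- e * h x))).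
  exact: (is_deriveZ e (is_deriveD (is_deriveZ 4^-1 (is_deriveV rhon0 drho))
    (is_deriveZ (4 * K)^-1 dH))).
have dg : is_derive x 1 (fun y => f y + - c) (w x + 0).
  exact: (is_deriveD dfx (is_derive_cst (- c) x 1)).
have dG := is_deriveM dpsi (is_deriveM dg dg).
have -> : derive1 G x = psi x * (2 * (f x - c) * w x) + (f x - c) ^+ 2 *
    (- (s x / (4 * rho x ^+ 2)) - h x / (4 * K)).
  transitivity ('D_1 (psi * ((fun y => f y + - c) * (fun y => f y + - c))) x).
    by rewrite derive1E.
  rewrite (@derive_val _ _ _ _ _ _ _ dG) /GRing.scale/= addr0.
  rewrite (_ : ((fun y => f y + - c) * (fun y => f y + - c)) x = (f x - c) ^+ 2)//.
  transitivity (psi x * (2 * (f x - c) * w x) + (f x - c) ^+ 2 *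
    (- (e ^+ 2 * s x / (4 * rho x ^+ 2)) - e ^+ 2 * h x / (4 * K))).
    by field; rewrite rhon0 gt_eqF.
  by rewrite ee !mul1r.
rewrite -!EFinM -!EFinD lee_fin.
have y0 := psi0 x (ltW px) (ltW xq).
(* Since [rho H <= K], the second summand is at most the first. *)
have yle : 4^-1 * (rho x)^-1 + (4 * K)^-1 * H x <= (2 * rho x)^-1.
  have : H x / (4 * K) <= (4 * rho x)^-1.
    rewrite ler_pdivrMr// mulrC ler_pdivlMr ?mulr_gt0//; nra.
  have -> : (2 * rho x)^-1 = (4 * rho x)^-1 + (4 * rho x)^-1 by field.
  have -> : 4^-1 * (rho x)^-1 = (4 * rho x)^-1 by field.
  have -> : (4 * K)^-1 * H x = H x / (4 * K) by rewrite mulrC.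
  lra.
have psi2 : psi x ^+ 2 <= (4 * rho x ^+ 2)^-1.
  rewrite /psi exprMn ee mul1r (_ : (4 * rho x ^+ 2)^-1 = (2 * rho x)^-1 ^+ 2); last by field.
  by rewrite ler_sqr ?nnegrE// invr_ge0 mulr_ge0// ltW.
have sq : 0 <= w x ^+ 2 / s x + s x * psi x ^+ 2 * (f x - c) ^+ 2
    - 2 * psi x * (f x - c) * w x.
  rewrite (_ : _ - _ = (w x - s x * psi x * (f x - c)) ^+ 2 / s x).
    by rewrite divr_ge0 ?sqr_ge0 ?ltW.
  by field; rewrite gt_eqF.
have sle : s x * psi x ^+ 2 * (f x - c) ^+ 2 <= s x * (4 * rho x ^+ 2)^-1 * (f x - c) ^+ 2.
  by apply: ler_wpM2r; rewrite ?sqr_ge0//; apply: ler_wpM2l => //; exact: ltW.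
(* The term [- h / (4 K)] in the derivative of [psi] cancels the Hardy integrand exactly; what is
   left is [sq] combined with [sle]. *)
rewrite (_ : 4 * K * _ + _ = 4 * K * (2 * psi x * (f x - c) * w x -
  s x * (4 * rho x ^+ 2)^-1 * (f x - c) ^+ 2)); last by field; rewrite rhon0 gt_eqF.
rewrite ler_pM2l//; lra.
Qed.



End abs_cont_integral.

(** * Scale, speed measure and choice of the reference point *)

Section density_integral.
Import HBSimple HBNNSimple.
Context {R : realType}.
Variables (D : set R) (w : R -> R).
Hypotheses (mD : measurable D) (mw : measurable_fun D w)
  (w_ge0 : forall x, D x -> 0 <= w x).
Local Notation leb := (@lebesgue_measure R).
Local Open Scope ereal_scope.

Let dm : {measure set (measurableTypeR R) -> \bar R} := density_measure mD mw w_ge0.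

(** True for indicators by definition of the measure, then for simple functions by linearity, then
    in general by monotone convergence. *)
Let integral_density_setT (f : measurableTypeR R -> \bar R) :
  measurable_fun setT f -> (forall x, 0 <= f x) ->
  \int[dm]_x f x = \int[leb]_(x in D) (f x * (w x)%:E).
Proof.
move=> mf f0; pose h := nnsfun_approx measurableT mf.
have mwE : measurable_fun D (fun x => (w x)%:E) by exact/measurable_EFinP.
pose hE n (x : measurableTypeR R) := (h n x)%:E.
have mh n : measurable_fun setT (hE n) by exact/measurable_EFinP/measurable_funP.
have hx x : hE n x @[n --> \oo] --> f x by exact: cvg_nnsfun_approx.
transitivity (limn (fun n => \int[dm]_x hE n x)).
  rewrite -monotone_convergence//.
  - by apply: eq_integral => x _; apply/esym/cvg_lim => //; exact: hx.
  - by move=> n x _; rewrite lee_fin.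
  - by move=> x _ i j ij; rewrite lee_fin; exact/lefP/nd_nnsfun_approx.
transitivity (limn (fun n => \int[leb]_(x in D) (hE n x * (w x)%:E))); last first.
  rewrite -monotone_convergence//.
  - apply: eq_integral => x /[!inE] Dx; apply/cvg_lim => //.
    by apply: cvgeZr => //; exact: hx.
  - by move=> n; apply: emeasurable_funM => //; exact: measurable_funS (mh n).
  - by move=> n x Dx; rewrite mule_ge0 ?lee_fin// w_ge0.
  - move=> x Dx i j ij; rewrite lee_wpmul2r ?lee_fin ?w_ge0//.
    exact/lefP/nd_nnsfun_approx.
congr (limn _); apply/funext => n.
transitivity (\int[dm]_x \sum_(y \in range (h n)) (y * \1_(h n @^-1` [set y]) x)%:E).
  by apply: eq_integral => t _; rewrite /hE fimfunE -fsumEFin.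
have mind r : measurable_fun setT (fun x : measurableTypeR R => (r * \1_(h n @^-1` [set r]) x)%:E).
  by apply: (measurable_comp measurableT) => //; exact: measurable_funM.
rewrite ge0_integral_fsum//; last by move=> y x _; exact: nnfun_muleindic_ge0.
transitivity (\int[leb]_(x in D) (\sum_(y \in range (h n))
    (y * \1_(h n @^-1` [set y]) x)%:E * (w x)%:E)); last first.
  apply: eq_integral => x _.
  rewrite -ge0_mule_fsuml => [|y]; last exact: nnfun_muleindic_ge0.
  by rewrite /hE fsumEFin // -(fimfunE _ x).
rewrite ge0_integral_fsum//; last 2 first.
  - by move=> y; apply: emeasurable_funM => //; exact: measurable_funS (mind y).
  - move=> y x Dx; apply: mule_ge0; first exact: nnfun_muleindic_ge0.
    by rewrite lee_fin w_ge0.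
apply: eq_fsbigr => r rhn; have r0 : (0 <= r)%R.
  by move: rhn; rewrite inE => -[t _ <-].
have mpre : measurable (h n @^-1` [set r]).
  by rewrite -[X in measurable X]setTI; exact: measurable_funP.
under eq_integral do rewrite EFinM.
rewrite ge0_integralZl//; last exact/measurable_EFinP.
under [RHS]eq_integral do rewrite EFinM -muleA.
rewrite ge0_integralZl//; last 2 first.
  - by apply: emeasurable_funM => //; exact/measurable_EFinP.
  - by move=> x Dx; rewrite mule_ge0 ?lee_fin ?w_ge0.
congr (_ * _); rewrite integral_indic// setIT /dm/= /density_measure setIC.
rewrite integral_mkcondr; apply: eq_integral => x _.
by rewrite muleC epatch_indic.
Qed.

Lemma ge0_integral_density_measure (E : set R) (f : R -> \bar R) :
  measurable E -> measurable_fun E f -> (forall x, E x -> 0 <= f x) ->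
  \int[density_measure mD mw w_ge0]_(x in E) f x =
  \int[leb]_(x in E `&` D) (f x * (w x)%:E).
Proof.
move=> mE mf f0; rewrite integral_mkcond.
transitivity (\int[dm]_x (f \_ E) x); first by [].
rewrite integral_density_setT//.
- rewrite setIC integral_mkcondr; apply: eq_integral => x _.
  by rewrite !patchE; case: ifP => // _; exact: mul0e.
- by apply/(measurable_restrictT f mE).
- by move=> x; rewrite patchE; case: ifPn => // /set_mem/f0.
Qed.

End density_integral.

Section positive_integral.
Context {R : realType}.
Local Notation leb := (@lebesgue_measure R).

(** The integral is at least the length times the minimum of [k], which is attained and hence
    positive. *)
Lemma Rintegral_continuous_gt0 (p q : R) (k : R -> R) : p < q ->
  (forall x, p <= x -> x <= q -> {for x, continuous k}) ->
  (forall x, p <= x -> x <= q -> 0 < k x) ->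
  0 < \int[leb]_(x in `[p, q]) k x.
Proof.
move=> pq ck k0.
have ckw : {within `[p, q], continuous k}.
  apply: continuous_in_subspaceT => x; rewrite inE/= in_itv/= => /andP[px xq].
  exact: ck.
have [c] := EVT_min (ltW pq) ckw; rewrite in_itv/= => /andP[pc cq] Hc.
apply: (@lt_le_trans _ _ (\int[leb]_(x in `[p, q]) k c)).
  rewrite Rintegral_cst//= lebesgue_measure_itv/= lte_fin pq -EFinB/=.
  by rewrite mulr_gt0 ?k0// subr_gt0.
apply: le_Rintegral => //.
- apply: continuous_compact_integrable; first exact: segment_compact.
  by apply: continuous_subspaceT => ?; exact: cst_continuous.
- exact: continuous_itv_integrable ck.
Qed.

End positive_integral.

(** * Scale function, masses on either side of a point, and the balanced point *)

Section diffusion_setup.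
Context {R : realType}.
Variables (M N : \bar R) (theta : R) (a b : R -> R).
Hypotheses (Itheta : state_space M N theta)
  (ca : {within closed_state_space M N, continuous a})
  (cb : {within closed_state_space M N, continuous b})
  (a_gt0 : forall x, closed_state_space M N x -> 0 < a x).
Local Notation leb := (@lebesgue_measure R).
Local Notation I := (state_space M N).
Local Notation mu := (speed_measure Itheta ca cb a_gt0).
Local Notation nu := (scale_measure Itheta ca cb a_gt0).
Local Notation s := (scale_density theta a b).
Local Notation h := (speed_density theta a b).

Lemma state_space_between p q x : I p -> I q -> p <= x -> x <= q -> I x.
Proof.
move=> Ip Iq px xq; apply: (state_space_itvcc Ip Iq) => /=.
by rewrite in_itv/= px.
Qed.

Lemma scale_density_continuous x : I x -> {for x, continuous s}.
Proof.
move=> Ix; rewrite /scale_density.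
apply: continuous_comp; last exact: continuous_expR.
by apply: continuousN; apply: (C_continuous Itheta ca cb a_gt0); rewrite inE.
Qed.

Lemma speed_density_continuous x : I x -> {for x, continuous h}.
Proof.
move=> Ix; have caI := continuous_subspaceW (@state_space_closed R M N) ca.
rewrite continuous_open_subspace in caI; last exact: open_state_space.
apply: cvgM.
  apply: continuous_comp; last exact: continuous_expR.
  by apply: (C_continuous Itheta ca cb a_gt0); rewrite inE.
apply: cvgV; last by apply: caI; rewrite inE.
by rewrite gt_eqF// a_gt0//; exact: state_space_closed.
Qed.

Lemma scale_density_gt0 x : 0 < s x.
Proof. exact: expR_gt0. Qed.

Lemma speed_density_gt0 x : I x -> 0 < h x.
Proof.
by move=> /state_space_closed/a_gt0 ax; rewrite divr_gt0// expR_gt0.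
Qed.

Lemma diffusion_speed_density x : I x -> a x * h x = (s x)^-1.
Proof.
move=> /state_space_closed/a_gt0 ax; rewrite /speed_density /scale_density expRN invrK.
by rewrite mulrC divfK// gt_eqF.
Qed.

Lemma measurable_speed_density_itv (J : interval R) : [set` J] `<=` I ->
  measurable_fun [set` J] h.
Proof.
move=> JI; apply: measurable_funS JI (measurable_speed_density Itheta ca cb a_gt0).
exact: measurable_state_space.
Qed.

Lemma measurable_scale_density_itv (J : interval R) : [set` J] `<=` I ->
  measurable_fun [set` J] s.
Proof.
move=> JI; apply: measurable_funS JI (measurable_scale_density Itheta ca cb a_gt0).
exact: measurable_state_space.
Qed.

Lemma ge0_integral_speed_measure (E : set R) (f : R -> \bar R) :
  measurable E -> measurable_fun E f -> (forall x, E x -> 0 <= f x)%E -> E `<=` I ->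
  (\int[mu]_(x in E) f x = \int[leb]_(x in E) (f x * (h x)%:E))%E.
Proof.
by move=> mE mf f0 EI; rewrite ge0_integral_density_measure// setIidl.
Qed.

(** A measure with a density has no atoms, so all four conventions at the endpoints give the same
    finite mass. *)
Lemma speed_measure_itv p q (b0 b1 : bool) : I p -> I q -> p <= q ->
  mu [set` Interval (BSide b0 p) (BSide b1 q)] = (\int[leb]_(x in `[p, q]) h x)%:E.
Proof.
move=> Ip Iq pq; have pqI := state_space_itvcc Ip Iq.
have hpq x : p <= x -> x <= q -> {for x, continuous h}.
  by move=> px xq; apply: speed_density_continuous; exact: state_space_between px xq.
have sub : [set` Interval (BSide b0 p) (BSide b1 q)] `<=` `[p, q].
  by apply: subset_itv; case: b0 b1 => -[]; rewrite bnd_simp.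
rewrite /=/density_measure setIidl; last exact: subset_trans pqI.
rewrite integral_itv_bndoo; last first.
  apply/measurable_EFinP; apply: measurable_speed_density_itv.
  by apply: subset_trans pqI; exact: subset_itv_oo_cc.
rewrite -(integral_itv_bndoo true false); last first.
  apply/measurable_EFinP; apply: measurable_speed_density_itv.
  by apply: subset_trans pqI; exact: subset_itv_oo_cc.
rewrite /Rintegral fineK//; apply: integrable_fin_num => //.
exact: continuous_itv_integrable hpq.
Qed.

Lemma scale_measure_itv p q : I p -> I q -> p <= q ->
  nu `[p, q]%classic = (\int[leb]_(x in `[p, q]) s x)%:E.
Proof.
move=> Ip Iq pq; have pqI := state_space_itvcc Ip Iq.
have spq x : p <= x -> x <= q -> {for x, continuous s}.
  by move=> px xq; apply: scale_density_continuous; exact: state_space_between px xq.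
rewrite /=/density_measure setIidl//.
rewrite /Rintegral fineK//; apply: integrable_fin_num => //.
exact: continuous_itv_integrable spq.
Qed.

Definition scale_function x := oriented_integral s theta x.
Local Notation sigma := scale_function.

Lemma scale_functionB p q : I p -> I q -> p <= q ->
  sigma q - sigma p = \int[leb]_(x in `[p, q]) s x.
Proof.
move=> Ip Iq pq.
have chasles u v w : I u -> I w -> u <= v -> v <= w ->
    \int[leb]_(x in `[u, w]) s x =
    \int[leb]_(x in `[u, v]) s x + \int[leb]_(x in `[v, w]) s x.
  move=> Iu Iw uv vw; have suw x : u <= x -> x <= w -> {for x, continuous s}.
    by move=> ux xw; apply: scale_density_continuous; exact: state_space_between ux xw.
  have int := continuous_itv_integrable suw.
  apply/eqP; rewrite addrC -subr_eq; apply/eqP.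
  rewrite (Rintegral_itvccB suw)// Rintegral_itv_obnd_cbnd//.
  by apply: integrableS int => //; apply: subset_itv; rewrite bnd_simp.
rewrite /scale_function /oriented_integral.
case: (leP theta q) => tq; case: (leP theta p) => tp.
- by rewrite (chasles theta p q)//; ring.
- by rewrite (chasles p theta q)// ?(ltW tp)//; ring.
- by have := le_lt_trans (le_trans tp pq) tq; rewrite ltxx.
- by rewrite (chasles p q theta)// ?(ltW tq)//; ring.
Qed.

Lemma scale_function_lt p q : I p -> I q -> p < q -> sigma p < sigma q.
Proof.
move=> Ip Iq pq; rewrite -subr_gt0 scale_functionB ?(ltW pq)//.
apply: Rintegral_continuous_gt0 => // x px xq; last exact: scale_density_gt0.
by apply: scale_density_continuous; exact: state_space_between px xq.
Qed.

Lemma scale_function_le p q : I p -> I q -> p <= q -> sigma p <= sigma q.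
Proof.
by move=> Ip Iq; rewrite le_eqVlt => /predU1P[->//|/(scale_function_lt Ip Iq)/ltW].
Qed.

Lemma scale_function_IVT p q c : I p -> I q -> p <= q -> sigma p <= c -> c <= sigma q ->
  exists2 m, I m & sigma m = c.
Proof.
move=> Ip Iq pq pc cq.
have spq x : p <= x -> x <= q -> {for x, continuous s}.
  by move=> px xq; apply: scale_density_continuous; exact: state_space_between px xq.
have cP : {within `[p, q], continuous (fun x => \int[leb]_(t in `[p, x]) s t)}.
  apply: parameterized_integral_continuous => //.
  exact: continuous_itv_integrable spq.
have [] := @IVT _ _ _ _ (c - sigma p) pq cP.
  rewrite -!scale_functionB// subrr; apply/andP; split.
    by rewrite ge_min subr_ge0 pc.
  by rewrite le_max lerD2r cq orbT.
move=> m; rewrite in_itv/= => /andP[pm mq] mE.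
have Im : I m by exact: state_space_between pm mq.
exists m => //; apply: (addIr (- sigma p)); rewrite -mE.
exact: scale_functionB.
Qed.

Hypothesis mufin : (mu I < +oo)%E.

Definition mass_left x := fine (mu (I `&` [set` `]-oo, x]])).
Definition mass_right x := fine (mu (I `&` [set` `[x, +oo[])).
Local Notation A := mass_left.
Local Notation B := mass_right.

Let mI : measurable I := measurable_state_space M N.

Let sub_fin (E : set R) : measurable E -> E `<=` I -> mu E \is a fin_num.
Proof.
move=> mE EI; rewrite ge0_fin_numE ?measure_ge0//; apply: le_lt_trans mufin.
by apply: (le_measure mu _ _ EI); rewrite inE; [exact: mE|exact: mI].
Qed.

Lemma mass_leftE x : mu (I `&` [set` `]-oo, x]]) = (A x)%:E.
Proof. by rewrite fineK//; apply: sub_fin; [exact: measurableI|exact: subIsetl]. Qed.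

Lemma mass_rightE x : mu (I `&` [set` `[x, +oo[]) = (B x)%:E.
Proof. by rewrite fineK//; apply: sub_fin; [exact: measurableI|exact: subIsetl]. Qed.

Lemma mass_left_ge0 x : 0 <= A x. Proof. exact: fine_ge0. Qed.
Lemma mass_right_ge0 x : 0 <= B x. Proof. exact: fine_ge0. Qed.

Lemma mass_left_le x : A x <= fine (mu I).
Proof.
have mE : measurable (I `&` [set` `]-oo, x]]) by exact: measurableI.
apply: fine_le; [by apply: sub_fin => //; exact: subIsetl|exact: sub_fin|].
by apply: (le_measure mu _ _ (@subIsetl _ _ _)); rewrite inE; [exact: mE|exact: mI].
Qed.

Lemma mass_right_le x : B x <= fine (mu I).
Proof.
have mE : measurable (I `&` [set` `[x, +oo[]) by exact: measurableI.
apply: fine_le; [by apply: sub_fin => //; exact: subIsetl|exact: sub_fin|].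
by apply: (le_measure mu _ _ (@subIsetl _ _ _)); rewrite inE; [exact: mE|exact: mI].
Qed.

Lemma mass_leftD p q : I p -> I q -> p <= q ->
  A q = A p + \int[leb]_(x in `[p, q]) h x.
Proof.
move=> Ip Iq pq; apply: EFin_inj; rewrite EFinD -(speed_measure_itv false false Ip Iq pq).
rewrite -!mass_leftE -measureU.
- congr (mu _); apply/seteqP; split => x /=; rewrite !in_itv/=.
    by case=> Ix xq; have [xp|px] := leP x p; [left|right].
  case=> [[Ix xp]|/andP[px xq]]; first by split => //; exact: le_trans pq.
  by split => //; exact: state_space_between (ltW px) xq.
- exact: measurableI.
- exact: measurable_itv.
- rewrite -subset0 => x /= []; rewrite !in_itv/= => -[_ xp] /andP[px _].
  by have := lt_le_trans px xp; rewrite ltxx.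
Qed.

Lemma mass_rightD p q : I p -> I q -> p <= q ->
  B p = B q + \int[leb]_(x in `[p, q]) h x.
Proof.
move=> Ip Iq pq; apply: EFin_inj; rewrite EFinD -(speed_measure_itv true true Ip Iq pq).
rewrite -!mass_rightE -measureU.
- congr (mu _); apply/seteqP; split => x /=; rewrite !in_itv/= ?andbT.
    by case=> Ix px; have [qx|xq] := leP q x; [left|right; rewrite px].
  case=> [[Ix qx]|/andP[px xq]]; first by split => //; exact: le_trans qx.
  by split => //; exact: state_space_between px (ltW xq).
- exact: measurableI.
- exact: measurable_itv.
- rewrite -subset0 => x /= []; rewrite !in_itv/= andbT => -[_ qx] /andP[_ xq].
  by have := lt_le_trans xq qx; rewrite ltxx.
Qed.

Let int_h_gt0 p q : I p -> I q -> p < q -> 0 < \int[leb]_(x in `[p, q]) h x.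
Proof.
move=> Ip Iq pq; apply: Rintegral_continuous_gt0 => // x px xq.
  by apply: speed_density_continuous; exact: state_space_between px xq.
by apply: speed_density_gt0; exact: state_space_between px xq.
Qed.

Lemma mass_left_gt0 x : I x -> 0 < A x.
Proof.
move=> Ix; have [u ux Iu] := state_space_lt Ix.
rewrite (mass_leftD Iu Ix (ltW ux)) ltr_wpDl ?mass_left_ge0//.
exact: int_h_gt0.
Qed.

Lemma mass_right_gt0 x : I x -> 0 < B x.
Proof.
move=> Ix; have [v xv Iv] := state_space_gt Ix.
rewrite (mass_rightD Ix Iv (ltW xv)) ltr_wpDl ?mass_right_ge0//.
exact: int_h_gt0.
Qed.

Lemma speed_mass_gt0 : 0 < fine (mu I).
Proof. exact: lt_le_trans (mass_left_gt0 Itheta) (mass_left_le _). Qed.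

(** The reference point [m] is chosen so that [sigma m] separates the values
    [sigma y - K / B y] from the values [sigma x + K / A x]. *)
Lemma balanced_point (K : R) : 0 < K ->
  (forall x y, I x -> I y -> x < y -> sigma y - sigma x <= K / A x + K / B y) ->
  exists m, [/\ I m, forall y, I y -> sigma y - sigma m <= K / B y &
    forall x, I x -> sigma m - sigma x <= K / A x].
Proof.
move=> K0 HK; set V := fine (mu I); have V0 : 0 < V := speed_mass_gt0.
pose F y := sigma y - K / B y; pose G x := sigma x + K / A x.
(* One-sided masses are at most [V], so the corrections [K / B y] and [K / A x] exceed the fixed
   positive margin [K / V]. This margin later forces [sigma] to reach the separating level inside
   the state space. *)
have KB y : I y -> K / V <= K / B y.
  by move=> Iy; rewrite ler_pM2l// lef_pV2 ?posrE ?mass_right_gt0// mass_right_le.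
have KA x : I x -> K / V <= K / A x.
  by move=> Ix; rewrite ler_pM2l// lef_pV2 ?posrE ?mass_left_gt0// mass_left_le.
have KV : 0 < K / V by rewrite divr_gt0.
have FG y x : I y -> I x -> F y <= G x.
  move=> Iy Ix; rewrite /F /G; have [xy|yx] := ltP x y; first by have := HK _ _ Ix Iy xy; lra.
  have := scale_function_le Iy Ix yx; have := KB _ Iy; have := KA _ Ix; lra.
pose SF := [set F y | y in I]; pose SG := [set G x | x in I].
have hF : has_sup SF.
  split; first by exists (F theta), theta.
  by exists (G theta) => _ [y Iy <-]; exact: FG.
have hG : has_inf SG.
  split; first by exists (G theta), theta.
  by exists (F theta) => _ [y Iy <-]; exact: FG.
have Fsup y : I y -> F y <= sup SF by move=> Iy; apply: (ub_le_sup hF.2); exists y.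
have Ginf x : I x -> inf SG <= G x by move=> Ix; apply: (ge_inf hG.2); exists x.
have supinf : sup SF <= inf SG.
  apply: (ge_sup hF.1) => _ [y Iy <-]; apply: (lb_le_inf hG.1) => _ [x Ix <-].
  exact: FG.
suff [m Im [mF mG]] : exists2 m, I m & sup SF <= sigma m /\ sigma m <= inf SG.
  exists m; split => // [y Iy|x Ix].
  - have := Fsup _ Iy; rewrite /F; lra.
  - have := Ginf _ Ix; rewrite /G; lra.
(* If [sigma theta] is too low, the level [sup SF] is reached to the right of [theta]: were [sigma]
   to stay below it everywhere, every [F y] would be at most [sup SF - K / V], which contradicts the
   supremum. The case of [sigma theta] above [inf SG] is symmetric. *)
have [tF|Ft] := ltP (sigma theta) (sup SF).
  have [y1 Iy1 y1F] : exists2 y, I y & sup SF <= sigma y.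
    apply: contrapT => nex.
    suff : sup SF <= sup SF - K / V by lra.
    apply: (ge_sup hF.1) => _ [y Iy <-].
    have ylt : sigma y < sup SF.
      by rewrite ltNge; apply/negP => h'; apply: nex; exists y.
    by have := KB _ Iy; rewrite /F; lra.
  have ty : theta <= y1.
    rewrite leNgt; apply/negP => /(scale_function_lt Iy1 Itheta); lra.
  have [m Im mE] := scale_function_IVT Itheta Iy1 ty (ltW tF) y1F.
  by exists m => //; rewrite mE.
have [Gt|tG] := ltP (inf SG) (sigma theta); last by exists theta.
have [x1 Ix1 x1G] : exists2 x, I x & sigma x <= inf SG.
  apply: contrapT => nex.
  suff : inf SG + K / V <= inf SG by lra.
  apply: (lb_le_inf hG.1) => _ [x Ix <-].
  have ylt : inf SG < sigma x.
    by rewrite ltNge; apply/negP => h'; apply: nex; exists x.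
  by have := KA _ Ix; rewrite /G; lra.
have xt : x1 <= theta.
  rewrite leNgt; apply/negP => /(scale_function_lt Itheta Ix1); lra.
have [m Im mE] := scale_function_IVT Ix1 Itheta xt x1G (ltW Gt).
by exists m => //; rewrite mE.
Qed.

End diffusion_setup.

(** * Lower bound *)

Section lower_bound.
Context {R : realType}.
Variables (M N : \bar R) (theta : R) (a b : R -> R).
Hypotheses (Itheta : state_space M N theta)
  (ca : {within closed_state_space M N, continuous a})
  (cb : {within closed_state_space M N, continuous b})
  (a_gt0 : forall x, closed_state_space M N x -> 0 < a x).
Local Notation leb := (@lebesgue_measure R).
Local Notation I := (state_space M N).
Local Notation mu := (speed_measure Itheta ca cb a_gt0).
Local Notation nu := (scale_measure Itheta ca cb a_gt0).
Local Notation s := (scale_density theta a b).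
Local Notation h := (speed_density theta a b).
Local Notation sigma := (scale_function theta a b).
Local Notation A := (mass_left Itheta ca cb a_gt0).
Local Notation B := (mass_right Itheta ca cb a_gt0).
Hypothesis mufin : (mu I < +oo)%E.

Let mI : measurable I := measurable_state_space M N.

Lemma diffusion_coefficient_measurable : measurable_fun I a.
Proof.
have caI := continuous_subspaceW (@state_space_closed R M N) ca.
rewrite continuous_open_subspace in caI; last exact: open_state_space.
by apply: open_continuous_measurable_fun; first exact: open_state_space.
Qed.

(** Where [derive1 f = w], the identity [a h = 1 / s] makes both integrands agree; the rest of the
    state space contributes a nonnegative amount. *)
Lemma dirichlet_form_ge (p q : R) (f w : R -> R) : I p -> I q -> p <= q ->
  measurable_fun setT w ->
  {ae leb, forall x, x \in `]p, q[ -> derivable f x 1 /\ derive1 f x = w x} ->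
  (\int[leb]_(x in `]p, q]) (w x ^+ 2 / s x)%:E <= dirichlet_form M N a mu f)%E.
Proof.
move=> Ip Iq pq mw [Z [mZ Z0 PZ]].
have sub : `]p, q[ `<=` I.
  by apply: subset_trans (state_space_itvcc Ip Iq); exact: subset_itv_oo_cc.
have mav (E : set R) : measurable E -> E `<=` I ->
    measurable_fun E (fun x => a x * w x ^+ 2).
  move=> mE EI; apply: measurable_funM.
    exact: measurable_funS EI diffusion_coefficient_measurable.
  by apply: measurable_funX; exact: measurable_funS mw.
have mh (E : set R) : measurable E -> E `<=` I -> measurable_fun E h.
  by move=> mE EI; apply: measurable_funS EI (measurable_speed_density Itheta ca cb a_gt0).
have wsE x : I x -> w x ^+ 2 / s x = a x * w x ^+ 2 * h x.
  by move=> Ix; rewrite -(diffusion_speed_density theta b a_gt0 Ix); ring.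
have mws (E : set R) : measurable E -> E `<=` I ->
    measurable_fun E (fun x => (w x ^+ 2 / s x)%:E).
  move=> mE EI; apply/measurable_EFinP.
  apply: (eq_measurable_fun (fun x => a x * w x ^+ 2 * h x)).
    by move=> x /[!inE] /EI /wsE.
  by apply: measurable_funM; [exact: mav|exact: mh].
have ws0 x : (0 <= (w x ^+ 2 / s x)%:E)%E.
  by rewrite lee_fin divr_ge0 ?sqr_ge0// ltW// scale_density_gt0.
(* Measurability of [derive1 f] is not established. On [E] it equals the measurable [w], so the
   integral is transported with [w] and compared pointwise with the Dirichlet integrand at the
   end. *)
pose E := `]p, q[ `\` Z.
have mE : measurable E by exact: measurableD.
have EI : E `<=` I by move=> x [/sub].
rewrite -(integral_itv_bndo_bndc (mws _ (measurable_itv _) sub)).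
have -> : (\int[leb]_(x in `]p, q[) (w x ^+ 2 / s x)%:E =
    \int[leb]_(x in E) (w x ^+ 2 / s x)%:E)%E.
  have -> : E = `]p, q[ `&` E by rewrite setIidr// => x [].
  rewrite integral_mkcondr; apply: ge0_ae_eq_integral => //.
  - exact: mws.
  - have mpq : measurable `]p, q[%classic by exact: measurable_itv.
    apply/(measurable_restrict _ mE mpq).
    by apply: mws; [exact: measurableI|move=> x [/sub]].
  - by move=> x _; rewrite patchE; case: ifP.
  - exists Z; split => // x /= /not_implyP[xpq nE].
    apply: contrapT => nZ; apply: nE; rewrite patchE mem_set//.
have -> : (\int[leb]_(x in E) (w x ^+ 2 / s x)%:E =
    \int[mu]_(x in E) (a x * w x ^+ 2)%:E)%E.
  rewrite ge0_integral_speed_measure//.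
  - by apply: eq_integral => x /[!inE] /EI Ix; rewrite -EFinM wsE.
  - by apply/measurable_EFinP; exact: mav.
  - move=> x /EI/state_space_closed/a_gt0 ax.
    by rewrite lee_fin mulr_ge0 ?sqr_ge0// ltW.
have -> : E = I `&` E by rewrite setIidr.
rewrite integral_mkcondr; apply: ge0_le_integral_nonmeasurable => x Ix.
  rewrite patchE; case: ifP => // _; rewrite lee_fin mulr_ge0 ?sqr_ge0//.
  exact/ltW/a_gt0/state_space_closed.
rewrite patchE; case: ifPn => [/set_mem [xpq nZ]|_]; last first.
  rewrite lee_fin mulr_ge0 ?sqr_ge0//; exact/ltW/a_gt0/state_space_closed.
suff [_ ->] : derivable f x 1 /\ derive1 f x = w x by [].
apply: contrapT => nd; apply: nZ; apply: PZ => /= imp; apply: nd; exact: imp.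
Qed.

(** On a compact subinterval [h] is bounded by continuity and [f - c] by absolute continuity. *)
Lemma speed_square_integrable (p q c : R) (f : R -> R) : I p -> I q -> p <= q ->
  measurable_fun setT f -> abs_cont p q f ->
  leb.-integrable `]p, q] (fun x => (h x * (f x - c) ^+ 2)%:E).
Proof.
move=> Ip Iq pq mf acf.
have [kf kf0 Hf] := abs_cont_bounded (abs_contD acf (abs_cont_cst p q (- c))).
have hpq x : p <= x -> x <= q -> {for x, continuous h}.
  move=> px xq; apply: (speed_density_continuous Itheta ca cb a_gt0).
  exact: state_space_between px xq.
have [kh kh0 Hh] := continuous_itv_bounded hpq.
have intc : leb.-integrable `[p, q] (EFin \o cst (kh * kf ^+ 2)).
  apply: continuous_compact_integrable; first exact: segment_compact.
  by apply: continuous_subspaceT => ?; exact: cst_continuous.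
have sub : `]p, q] `<=` `[p, q] by apply: subset_itvr; rewrite bnd_simp.
have intc' : leb.-integrable `]p, q] (EFin \o cst (kh * kf ^+ 2)).
  exact: integrableS intc.
apply: le_integrable intc' => //.
  apply/measurable_EFinP; apply: measurable_funM.
    apply: (measurable_speed_density_itv Itheta ca cb a_gt0).
    exact: subset_trans (state_space_itvcc Ip Iq).
  apply: measurable_funX; apply: measurable_funB => //.
  exact: measurable_funS mf.
move=> x; rewrite /= in_itv/= => /andP[/ltW px xq]; rewrite lee_fin.
rewrite /= [leRHS]ger0_norm; last by rewrite mulr_ge0 ?sqr_ge0// ltW.
rewrite normrM normrX.
apply: ler_pM => //; first exact: Hh.
by rewrite ler_sqr ?nnegrE ?(ltW kf0)//; exact: Hf.
Qed.

(** [riccati_hardy] is applied on each side of [m], with [rho] the scale distance to [m] raised by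
    [ep] and [H] the mass beyond the current point. The shift keeps [rho] away from 0 at [m]. *)
Lemma local_hardy (m K K' x y : R) (f : R -> R) : 0 < K -> K < K' ->
  (forall y, I y -> sigma y - sigma m <= K / B y) ->
  (forall x, I x -> sigma m - sigma x <= K / A x) ->
  measurable_fun setT f -> absolutely_continuous_in M N f ->
  I m -> I x -> I y -> x < m -> m < y ->
  (\int[mu]_(t in `]x, y]) ((f t - f m) ^+ 2)%:E <=
   (4 * K')%:E * dirichlet_form M N a mu f)%E.
Proof.
move=> K0 KK' HB HA mf acf Im Ix Iy xm my.
have xy := lt_trans xm my; have K'0 : 0 < K' := lt_trans K0 KK'.
have acxy : abs_cont x y f by exact/absolutely_continuous_on_abs_cont/acf.
have [w intw wE] := abs_cont_density (ltW xy) acxy.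
have aew := abs_cont_derivable_ae intw wE.
have mw : measurable_fun setT w by have /measurable_int/measurable_EFinP := intw.
have V0 : 0 < fine (mu I) := speed_mass_gt0 mufin.
(* The shift adds at most [ep] times the total mass to [rho H], which is exactly the room between
   [K] and [K']. *)
pose ep := (K' - K) / fine (mu I).
have ep0 : 0 < ep by rewrite divr_gt0// subr_gt0.
have epK : ep * fine (mu I) = K' - K by rewrite divfK// gt_eqF.
have cs p q t : I p -> I q -> p <= t -> t <= q -> {for t, continuous s}.
  move=> Ip Iq pt tq; apply: (scale_density_continuous Itheta ca cb a_gt0).
  exact: state_space_between pt tq.
have ch p q t : I p -> I q -> p <= t -> t <= q -> {for t, continuous h}.
  move=> Ip Iq pt tq; apply: (speed_density_continuous Itheta ca cb a_gt0).
  exact: state_space_between pt tq.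
have mws p q : I p -> I q -> measurable_fun `]p, q] (fun x => w x ^+ 2 / s x).
  move=> Ip Iq; have sub : `]p, q] `<=` I.
    by apply: subset_trans (state_space_itvcc Ip Iq); apply: subset_itvr; rewrite bnd_simp.
  have -> : (fun x => w x ^+ 2 / s x) = (fun x => w x ^+ 2 * expR (C_ theta a b x)).
    by apply/funext => t; rewrite /scale_density expRN invrK.
  apply: measurable_funM; first by apply: measurable_funX; exact: measurable_funS mw.
  apply: measurableT_comp; first exact: measurable_expR.
  apply: (@measurable_funS _ _ _ _ I) => //.
  apply: open_continuous_measurable_fun; first exact: open_state_space.
  exact: (C_continuous Itheta ca cb a_gt0).
have hardy_right : (\int[leb]_(t in `]m, y]) (h t * (f t - f m) ^+ 2)%:E <=
    (4 * K')%:E * \int[leb]_(t in `]m, y]) (w t ^+ 2 / s t)%:E)%E.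
  have cs' t : m <= t -> t <= y -> {for t, continuous s} := cs m y t Im Iy.
  have ch' t : m <= t -> t <= y -> {for t, continuous h} := ch m y t Im Iy.
  (* Here [rho t = ep + sigma t - sigma m] and [H t = B t], written through primitives starting at
     [m] so that they can be differentiated. *)
  apply: (@riccati_hardy _ m y (f m) 1 K' ep f w
    (fun t => ep + \int[leb]_(u in `[m, t]) s u)
    (fun t => B m + (- 1) * \int[leb]_(u in `[m, t]) h u)).
  - exact: ltW.
  - by rewrite eqxx.
  - exact: K'0.
  - exact: ep0.
  - exact: abs_contW (ltW xm) (lexx _) acxy.
  - by apply: abs_contD; [exact: abs_cont_cst|exact: primitive_abs_cont].
  - apply: abs_contD; first exact: abs_cont_cst.
    by apply: abs_contZ; exact: primitive_abs_cont.
  - move=> t mt ty; have It : I t by exact: state_space_between mt ty.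
    rewrite -(scale_functionB Itheta ca cb a_gt0 Im It mt).
    have -> : B m + -1 * \int[leb]_(u in `[m, t]) h u = B t.
      by rewrite (mass_rightD mufin Im It mt); ring.
    have := scale_function_le Itheta ca cb a_gt0 Im It mt.
    have := HB _ It; rewrite ler_pdivlMr ?(mass_right_gt0 mufin)// => HBt st.
    split; [lra|exact: mass_right_ge0|].
    have := ler_wpM2l (ltW ep0) (mass_right_le mufin t); rewrite epK; nra.
  - move=> t mt ty; split; first exact: scale_density_gt0.
      rewrite mul1r -[s t]add0r.
      exact: (is_deriveD (is_derive_cst ep t 1) (primitive_is_derive cs' mt ty)).
    rewrite -[X in is_derive _ _ _ X]add0r.
    exact: (is_deriveD (is_derive_cst (B m) t 1)
      (is_deriveZ (- 1) (primitive_is_derive ch' mt ty))).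
  - move: aew; apply: filterS; first exact: (ae_filter_ringOfSetsType leb).
    move=> t ft; rewrite in_itv/= => /andP[mt ty]; apply: ft.
    by rewrite in_itv/= (lt_trans xm mt).
  - exact: (fun _ => erefl).
  - by move=> /eqP; rewrite -subr_eq0 opprK (_ : 1 + 1 = 2)// pnatr_eq0.
  - apply: speed_square_integrable => //; first exact: ltW.
    exact: abs_contW (ltW xm) (lexx _) acxy.
  - exact: mws.
  - by move=> t _ _; exact/ltW/scale_density_gt0.
have hardy_left : (\int[leb]_(t in `]x, m]) (h t * (f t - f m) ^+ 2)%:E <=
    (4 * K')%:E * \int[leb]_(t in `]x, m]) (w t ^+ 2 / s t)%:E)%E.
  have cs' t : x <= t -> t <= m -> {for t, continuous s} := cs x m t Ix Im.
  have ch' t : x <= t -> t <= m -> {for t, continuous h} := ch x m t Ix Im.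
  (* The mirror image, with [e = -1]: [rho t = ep + sigma m - sigma t] decreases to [ep] at [m], and
     [H t = A t]. *)
  apply: (@riccati_hardy _ x m (f m) (- 1) K' ep f w
    (fun t => (ep + (sigma m - sigma x)) + (- 1) * \int[leb]_(u in `[x, t]) s u)
    (fun t => A x + \int[leb]_(u in `[x, t]) h u)).
  - exact: ltW.
  - by rewrite eqxx orbT.
  - exact: K'0.
  - exact: ep0.
  - exact: abs_contW (lexx _) (ltW my) acxy.
  - apply: abs_contD; first exact: abs_cont_cst.
    by apply: abs_contZ; exact: primitive_abs_cont.
  - by apply: abs_contD; [exact: abs_cont_cst|exact: primitive_abs_cont].
  - move=> t xt tm; have It : I t by exact: state_space_between xt tm.
    rewrite -(scale_functionB Itheta ca cb a_gt0 Ix It xt).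
    rewrite -(mass_leftD mufin Ix It xt).
    have := scale_function_le Itheta ca cb a_gt0 It Im tm.
    have := HA _ It; rewrite ler_pdivlMr ?(mass_left_gt0 mufin)// => HAt st.
    split; [lra|exact: mass_left_ge0|].
    have := ler_wpM2l (ltW ep0) (mass_left_le mufin t); rewrite epK; nra.
  - move=> t xt tm; split; first exact: scale_density_gt0.
      rewrite -[X in is_derive _ _ _ X]add0r.
      exact: (is_deriveD (is_derive_cst (ep + (sigma m - sigma x)) t 1)
        (is_deriveZ (- 1) (primitive_is_derive cs' xt tm))).
    rewrite opprK mul1r -[h t]add0r.
    exact: (is_deriveD (is_derive_cst (A x) t 1) (primitive_is_derive ch' xt tm)).
  - move: aew; apply: filterS; first exact: (ae_filter_ringOfSetsType leb).
    move=> t ft; rewrite in_itv/= => /andP[xt tm]; apply: ft.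
    by rewrite in_itv/= xt (lt_trans tm my).
  - by move=> /eqP; rewrite eq_sym -subr_eq0 opprK (_ : 1 + 1 = 2)// pnatr_eq0.
  - exact: (fun _ => erefl).
  - apply: speed_square_integrable => //; first exact: ltW.
    exact: abs_contW (lexx _) (ltW my) acxy.
  - exact: mws.
  - by move=> t _ _; exact/ltW/scale_density_gt0.
have subI : `]x, y] `<=` I.
  by apply: subset_trans (state_space_itvcc Ix Iy); apply: subset_itvr; rewrite bnd_simp.
have mfc : measurable_fun `]x, y] (fun t => (f t - f m) ^+ 2).
  apply: measurable_funX; apply: measurable_funB => //; exact: measurable_funS mf.
have splitE : `]x, y]%classic = `]x, m] `|` `]m, y]%classic.
  by apply: itv_bndbnd_setU; rewrite bnd_simp ltW.
have disj : [disjoint `]x, m]%classic & `]m, y]%classic].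
  rewrite disj_set2E; apply/eqP; rewrite -subset0 => t [] /=; rewrite !in_itv/=.
  by move=> /andP[_ tm] /andP[mt _]; have := lt_le_trans mt tm; rewrite ltxx.
rewrite ge0_integral_speed_measure//; last 2 first.
- exact/measurable_EFinP.
- by move=> t _; rewrite lee_fin sqr_ge0.
under eq_integral do rewrite -EFinM mulrC.
(* The energy between [x] and [y] is already below the Dirichlet form; it remains to add the two
   one-sided inequalities. *)
apply: (@le_trans _ _ ((4 * K')%:E *
    \int[leb]_(t in `]x, y]) (w t ^+ 2 / s t)%:E)%E); last first.
  apply: lee_wpmul2l; first by rewrite lee_fin mulr_ge0 ?ltW.
  exact: dirichlet_form_ge (ltW xy) mw aew.
rewrite splitE ge0_integral_setU//; last 2 first.
- rewrite -splitE; apply/measurable_EFinP; apply: measurable_funM => //.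
  exact: (measurable_speed_density_itv Itheta ca cb a_gt0).
- rewrite -splitE => t /subI It; rewrite lee_fin mulr_ge0 ?sqr_ge0//.
  exact/ltW/(speed_density_gt0 theta b a_gt0).
rewrite ge0_integral_setU//; last 2 first.
- by rewrite -splitE; apply/measurable_EFinP; exact: mws.
- by move=> t _; rewrite lee_fin divr_ge0 ?sqr_ge0// ltW// scale_density_gt0.
rewrite ge0_muleDr; first exact: leeD.
- by apply: integral_ge0 => t _; rewrite lee_fin divr_ge0 ?sqr_ge0// ltW// scale_density_gt0.
- by apply: integral_ge0 => t _; rewrite lee_fin divr_ge0 ?sqr_ge0// ltW// scale_density_gt0.
Qed.

End lower_bound.

(** * Exhaustion of the state space by compactly contained intervals *)

Section exhaustion.
Context {R : realType}.

Lemma ereal_exhaustion_below (l : \bar R) (m : R) : (l < m%:E)%E ->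
  exists x_ : nat -> R, [/\ forall n, (l < (x_ n)%:E)%E /\ x_ n < m,
    forall i j, (i <= j)%N -> x_ j <= x_ i &
    forall t, (l < t%:E)%E -> exists n, x_ n < t].
Proof.
case: l => [r| |] //; last first.
  move=> _; exists (fun n => m - n.+1%:R); split.
  - by move=> n; rewrite ltNyr ltrBlDr ltrDl ltr0n.
  - by move=> i j ij; rewrite lerD2l lerN2 ler_nat.
  - move=> t _; exists (Num.bound `|m - t|); rewrite ltrBlDr -ltrBlDl.
    apply: le_lt_trans (ler_norm _) _; apply: lt_le_trans (archi_boundP (normr_ge0 _)) _.
    by rewrite ler_nat.
rewrite lte_fin => rm; have mr : 0 < m - r by rewrite subr_gt0.
(* The denominator starts at 2, since 1 would give the point [m] itself. *)
exists (fun n => r + (m - r) / n.+2%:R); split.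
- move=> n; rewrite lte_fin ltrDl divr_gt0//; split=> //.
  rewrite -ltrBrDl ltr_pdivrMr// ltr_pMr// ltr1n//.
- by move=> i j ij; rewrite lerD2l ler_pM2l// lef_pV2 ?posrE// ler_nat.
- move=> t; rewrite lte_fin => rt; have tr : 0 < t - r by rewrite subr_gt0.
  exists (Num.bound ((m - r) / (t - r))).
  rewrite -ltrBrDl ltr_pdivrMr// mulrC -ltr_pdivrMr//.
  apply: lt_le_trans (archi_boundP _) _; first by rewrite divr_ge0// ltW.
  by rewrite ler_nat -addn2 leq_addr.
Qed.

Lemma state_space_exhaustion (M N : \bar R) (m : R) : state_space M N m ->
  exists x_ y_ : nat -> R,
    [/\ forall n, [/\ state_space M N (x_ n), state_space M N (y_ n), x_ n < m & m < y_ n],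
        forall i j, (i <= j)%N -> `]x_ i, y_ i]%classic `<=` `]x_ j, y_ j]%classic &
        \bigcup_n `]x_ n, y_ n]%classic = state_space M N].
Proof.
move=> Im; have /andP[Mm mN] := Im.
have [x_ [x1 x2 x3]] := ereal_exhaustion_below Mm.
(* The right end is obtained from the left one by the reflection [t -> - t]. *)
have [z_ [z1 z2 z3]] : exists x_ : nat -> R, [/\ forall n, (- N < (x_ n)%:E)%E /\ x_ n < - m,
    forall i j, (i <= j)%N -> x_ j <= x_ i &
    forall t, (- N < t%:E)%E -> exists n, x_ n < t].
  by apply: ereal_exhaustion_below; rewrite EFinN lteN2.
have Ix n : state_space M N (x_ n).
  have [Mx xm] := x1 n; apply/andP; split => //.
  by apply: lt_trans mN; rewrite lte_fin.
have Iy n : state_space M N (- z_ n).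
  have [Nz zm] := z1 n; apply/andP; split.
    by apply: lt_trans Mm _; rewrite lte_fin ltrNr.
  by rewrite EFinN lteNl.
have mono i j : (i <= j)%N -> `]x_ i, - z_ i]%classic `<=` `]x_ j, - z_ j]%classic.
  by move=> ij; apply: subset_itv; rewrite bnd_simp ?lerN2 ?x2 ?z2.
exists x_, (fun n => - z_ n); split => //.
  by move=> n; split => //; [have [] := x1 n|rewrite ltrNr; have [] := z1 n].
apply/seteqP; split => [t [n _]|t /andP[Mt tN]].
  rewrite /= in_itv/= => /andP[xt tz].
  exact: state_space_between (Ix n) (Iy n) (ltW xt) tz.
have [n1 n1t] := x3 _ Mt.
have [n2 n2t] : exists n, z_ n < - t by apply: z3; rewrite EFinN lteN2.
exists (maxn n1 n2) => //=; rewrite in_itv/=; apply/andP; split.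
  by apply: le_lt_trans n1t; apply: x2; exact: leq_maxl.
rewrite lerNr; apply/ltW; apply: le_lt_trans n2t; apply: z2; exact: leq_maxr.
Qed.

End exhaustion.

(** * Passage to the whole interval and conclusion of the lower bound *)

Section lower_bound_conclusion.
Context {R : realType}.
Variables (M N : \bar R) (theta : R) (a b : R -> R).
Hypotheses (Itheta : state_space M N theta)
  (ca : {within closed_state_space M N, continuous a})
  (cb : {within closed_state_space M N, continuous b})
  (a_gt0 : forall x, closed_state_space M N x -> 0 < a x).
Local Notation leb := (@lebesgue_measure R).
Local Notation I := (state_space M N).
Local Notation mu := (speed_measure Itheta ca cb a_gt0).
Local Notation nu := (scale_measure Itheta ca cb a_gt0).
Local Notation sigma := (scale_function theta a b).
Local Notation A := (mass_left Itheta ca cb a_gt0).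
Local Notation B := (mass_right Itheta ca cb a_gt0).
Hypothesis mufin : (mu I < +oo)%E.

Let mI : measurable I := measurable_state_space M N.

Lemma speed_measure_setT : mu setT = mu I.
Proof. by rewrite /=/density_measure setTI setIid. Qed.

Lemma speed_measureE : mu I = (fine (mu I))%:E.
Proof. by rewrite fineK// ge0_fin_numE. Qed.

Lemma ge0_integral_speed_measure_setT (f : R -> \bar R) :
  measurable_fun setT f -> (forall x, 0 <= f x)%E ->
  (\int[mu]_x f x = \int[mu]_(x in I) f x)%E.
Proof.
move=> mf f0; rewrite (ge0_integral_density_measure _ _ _ measurableT mf)//.
rewrite (ge0_integral_density_measure _ _ _ mI)//; last exact: measurable_funS mf.
by rewrite setTI setIid.
Qed.

(** Monotone convergence along an exhaustion around [m]; the constant in [local_hardy] does not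
    depend on the subinterval. *)
Lemma global_hardy (m K K' : R) (f : R -> R) : 0 < K -> K < K' ->
  (forall y, I y -> sigma y - sigma m <= K / B y) ->
  (forall x, I x -> sigma m - sigma x <= K / A x) ->
  measurable_fun setT f -> absolutely_continuous_in M N f -> I m ->
  (\int[mu]_t ((f t - f m) ^+ 2)%:E <= (4 * K')%:E * dirichlet_form M N a mu f)%E.
Proof.
move=> K0 KK' HB HA mf acf Im.
have mfm : measurable_fun setT (fun t => (f t - f m) ^+ 2).
  by apply: measurable_funX; apply: measurable_funB.
rewrite ge0_integral_speed_measure_setT; last 2 first.
- exact/measurable_EFinP.
- by move=> t; rewrite lee_fin sqr_ge0.
have [x_ [y_ [xy mono <-]]] := state_space_exhaustion Im.
have cvg : (\int[mu]_(t in `]x_ n, y_ n]) ((f t - f m) ^+ 2)%:E)%E @[n --> \oo] -->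
   (\int[mu]_(t in \bigcup_n `]x_ n, y_ n]%classic) ((f t - f m) ^+ 2)%:E)%E.
  apply: ge0_nondecreasing_set_cvg_integral => //.
  - by move=> i j ij; apply/subsetPset; exact: mono.
  - move=> n; apply/measurable_EFinP; exact: measurable_funS mfm.
  - by move=> n t _; rewrite lee_fin sqr_ge0.
rewrite -(cvg_lim _ cvg)//; apply: lime_le; first by apply/cvg_ex; eexists; exact: cvg.
apply: nearW => n; have [Ix Iy xm my] := xy n.
exact: local_hardy KK' HB HA mf acf Im Ix Iy xm my.
Qed.

Lemma speed_measure_integrable_cst (k : R) : mu.-integrable setT (EFin \o cst k).
Proof.
apply/integrableP; split; first exact/measurable_EFinP.
rewrite [X in (X < _)%E](_ : _ = \int[mu]_x (cst `|k|%:E x))%E//.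
by rewrite integral_cst//= speed_measure_setT speed_measureE -EFinM ltry.
Qed.

(** The total mass is positive and finite, so [mnormalize] is a genuine rescaling; the formula for
    nonnegative functions is applied to the positive and negative parts. *)
Lemma integral_stationary_distribution (f : R -> R) :
  mu.-integrable setT (EFin \o f) ->
  (\int[stationary_distribution theta mu]_x (f x)%:E =
   ((fine (mu I))^-1)%:E * \int[mu]_x (f x)%:E)%E.
Proof.
move=> int1; have mu0 : 0 < fine (mu I) := speed_mass_gt0 mufin.
have muT : mu setT = (fine (mu I))%:E by rewrite speed_measure_setT speed_measureE.
have V1 : 0 <= (fine (mu I))^-1 by rewrite invr_ge0 ltW.
have piE (g : R -> \bar R) : measurable_fun setT g -> (forall x, 0 <= g x)%E ->
    (\int[stationary_distribution theta mu]_x g x =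
     ((fine (mu I))^-1)%:E * \int[mu]_x g x)%E.
  move=> mg g0; rewrite (eq_measure_integral (mscale (NngNum V1) mu)).
    by rewrite ge0_integral_mscale.
  move=> E mE _; rewrite /= /stationary_distribution/= /mnormalize muT.
  by rewrite eqe gt_eqF//= /mscale/= muleC.
have mfE : measurable_fun setT (EFin \o f) by exact: measurable_int int1.
rewrite integralE [in RHS]integralE.
rewrite !piE//; try exact: measurable_funepos; try exact: measurable_funeneg.
rewrite -(fineK (integrable_pos_fin_num measurableT int1)).
rewrite -(fineK (integrable_neg_fin_num measurableT int1)) -!(EFinM, EFinB).
by rewrite -mulrBr.
Qed.

(** As [f] has mean zero and norm 1, expanding the square gives 1 plus the nonnegative integral of
    [c ^+ 2]. *)
Lemma admissible_variance (f : R -> R) (c : R) : admissible M N theta mu f ->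
  (1 <= \int[mu]_t ((f t - c) ^+ 2)%:E)%E.
Proof.
move=> [fL acf pif normf].
have mf : measurable_fun setT f.
  by have /set_mem := sub_Lfun_mfun fL.
have mu0 : 0 < fine (mu I) := speed_mass_gt0 mufin.
have int2 : mu.-integrable setT (fun x => (f x ^+ 2)%:E) := Lfun2_integrable_sqr fL.
have int1c (k : R) := speed_measure_integrable_cst k.
(* The measure being finite, [1 + f ^+ 2] is integrable, and it dominates the absolute value of
   [f]. *)
have int1 : mu.-integrable setT (EFin \o f).
  have intg : mu.-integrable setT (fun x => 1%:E + (f x ^+ 2)%:E)%E.
    exact: integrableD (int1c 1) int2.
  apply: le_integrable intg => //; first exact/measurable_EFinP.
  move=> x _; rewrite /= lee_fin [leRHS]ger0_norm; last by rewrite addr_ge0 ?sqr_ge0.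
  rewrite -(real_normK (num_real (f x))).
  by have := sqr_ge0 (`|f x| - 1); have := normr_ge0 (f x); nra.
have intf : (\int[mu]_x (f x)%:E = 0)%E.
  move/eqP: pif; rewrite integral_stationary_distribution// mule_eq0 eqe invr_eq0.
  by rewrite gt_eqF//= => /eqP.
have -> : 1%E = (\int[mu]_x ((f x ^+ 2)%:E + (- 2 * c)%:E * (f x)%:E))%E.
  rewrite integralD//; last exact: integrableZl.
  rewrite integralZl// intf mule0 adde0.
  have : ('N[mu]_2%:E[EFin \o f] `^ 2)%E = 1%E by rewrite normf poweR1r.
  rewrite powR_Lnorm// => <-; apply: eq_integral => x _.
  by rewrite /= ?poweR_EFin powR_mulrn// real_normK// num_real.
apply: (@le_trans _ _ (\int[mu]_x ((f x ^+ 2)%:E + (- 2 * c)%:E * (f x)%:E + (c ^+ 2)%:E))%E).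
  apply: le_integral.
  - exact: measurableT.
  - by apply: integrableD => //; exact: integrableZl.
  - apply: integrableD => //; first by apply: integrableD => //; exact: integrableZl.
    exact: int1c.
  - by move=> x _; rewrite leeDl// lee_fin sqr_ge0.
rewrite le_eqVlt; apply/orP; left; apply/eqP; apply: eq_integral => x _.
rewrite -EFinM -!EFinD; congr (_%:E); ring.
Qed.

(** Both masses and the scale length are finite and nonzero, so the extended inverses are the real
    ones. *)
Lemma kappa_inv_elementE x y : I x -> I y -> x < y ->
  (((mu (I `&` [set` `]-oo, x]]))^-1 + (mu (I `&` [set` `[y, +oo[]))^-1)
     * (nu [set` `[x, y]])^-1 = (((A x)^-1 + (B y)^-1) / (sigma y - sigma x))%:E)%E.
Proof.
move=> Ix Iy xy; rewrite (mass_leftE mufin) (mass_rightE mufin).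
rewrite (scale_measure_itv Itheta ca cb a_gt0 Ix Iy (ltW xy)).
rewrite -(scale_functionB Itheta ca cb a_gt0 Ix Iy (ltW xy)).
have nA : (A x == 0) = false by rewrite gt_eqF//; exact: (mass_left_gt0 mufin).
have nB : (B y == 0) = false by rewrite gt_eqF//; exact: (mass_right_gt0 mufin).
have nS : (sigma y - sigma x == 0) = false.
  by rewrite gt_eqF// subr_gt0; exact: (scale_function_lt Itheta ca cb a_gt0).
by rewrite !inver nA nB nS.
Qed.

Lemma dirichlet_form_ge0 (f : R -> R) : (0 <= dirichlet_form M N a mu f)%E.
Proof.
apply: integral_ge0 => x Ix; rewrite lee_fin mulr_ge0 ?sqr_ge0//.
exact/ltW/a_gt0/state_space_closed.
Qed.

Lemma kappa_inv_fin : exists2 k : R, 0 <= k & kappa_inv M N mu nu = k%:E.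
Proof.
have k0 : (0 <= kappa_inv M N mu nu)%E.
  apply: le_ereal_inf_tmp => _ [[x y] /= [Ix Iy xy] <-].
  rewrite kappa_inv_elementE// lee_fin; apply: divr_ge0.
    by apply: addr_ge0; rewrite invr_ge0; [exact: mass_left_ge0|exact: mass_right_ge0].
  by rewrite subr_ge0; exact/ltW/(scale_function_lt Itheta ca cb a_gt0).
have [y ty Iy] := state_space_gt Itheta.
have kfin : kappa_inv M N mu nu \is a fin_num.
  rewrite ge0_fin_numE//.
  apply: le_lt_trans (ltry (((A theta)^-1 + (B y)^-1) / (sigma y - sigma theta))).
  by apply: ereal_inf_lbound; exists (theta, y) => //=; exact: kappa_inv_elementE.
by exists (fine (kappa_inv M N mu nu)); [exact: fine_ge0|rewrite fineK].
Qed.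

Lemma kappa_inv_le_lambda1 :
  ((4^-1)%:E * kappa_inv M N mu nu <= lambda1 M N theta a mu)%E.
Proof.
apply: le_ereal_inf_tmp => _ [f fadm <-].
have [k k_ge0 kE] := kappa_inv_fin; rewrite kE.
(* The value 0 corresponds to an infinite [kappa], for which the lower bound is trivial. *)
have [->|kn0] := eqVneq k 0; first by rewrite mule0 dirichlet_form_ge0.
have k0 : 0 < k by rewrite lt_neqAle eq_sym kn0.
(* The infimum bound, solved for the scale length, is the hypothesis of [balanced_point] with
   [K = k^-1]. *)
have Hk x y : I x -> I y -> x < y -> sigma y - sigma x <= k^-1 / A x + k^-1 / B y.
  move=> Ix Iy xy.
  have sxy : 0 < sigma y - sigma x.
    by rewrite subr_gt0; exact: (scale_function_lt Itheta ca cb a_gt0).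
  have : k <= ((A x)^-1 + (B y)^-1) / (sigma y - sigma x).
    rewrite -lee_fin -kE -kappa_inv_elementE//.
    by apply: ereal_inf_lbound; exists (x, y).
  rewrite ler_pdivlMr// -mulrDr -ler_pdivrMl ?invr_gt0// invrK mulrC.
  by rewrite mulrC.
have K0 : 0 < k^-1 by rewrite invr_gt0.
have [m [Im HB HA]] := balanced_point mufin K0 Hk.
have [fL acf _ _] := fadm.
have mf : measurable_fun setT f by have /set_mem := sub_Lfun_mfun fL.
have bound K' : k^-1 < K' -> (1 <= (4 * K')%:E * dirichlet_form M N a mu f)%E.
  move=> KK'; apply: le_trans (admissible_variance (f m) fadm) _.
  exact: global_hardy K0 KK' HB HA mf acf Im.
have := dirichlet_form_ge0 f.
case: (dirichlet_form M N a mu f) bound => [d| |] bound; [|by move=> _; exact: leey|by []].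
rewrite lee_fin => d0; rewrite -EFinM lee_fin leNgt; apply/negP => dk.
have dk1 : 4 * k^-1 * d < 1.
  by rewrite mulrAC ltr_pdivrMr// mul1r -ltr_pdivlMl.
pose de := 1 - 4 * k^-1 * d; have de0 : 0 < de by rewrite subr_gt0.
have d1 : 0 < d + 1 by rewrite ltr_wpDl.
(* [K'] exceeds [k^-1] by so little that [4 K' d] grows by at most [de / 2], half of the gap below
   1; the summand 1 in [d + 1] guards against [d = 0]. *)
have := bound (k^-1 + de / (8 * (d + 1))); rewrite ltrDl divr_gt0 ?mulr_gt0// => /(_ isT).
rewrite -EFinM lee_fin.
have dd1 : d / (d + 1) <= 1 by rewrite ler_pdivrMr// mul1r lerDl.
have -> : 4 * (k^-1 + de / (8 * (d + 1))) * d = 4 * k^-1 * d + de / 2 * (d / (d + 1)).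
  by field; rewrite !gt_eqF.
have : de / 2 * (d / (d + 1)) <= de / 2 by rewrite ler_piMr// divr_ge0// ltW.
rewrite /de in de0 *; lra.
Qed.

End lower_bound_conclusion.

(** * Upper bound *)

Section upper_bound.
Context {R : realType}.
Variables (M N : \bar R) (theta : R) (a b : R -> R).
Hypotheses (Itheta : state_space M N theta)
  (ca : {within closed_state_space M N, continuous a})
  (cb : {within closed_state_space M N, continuous b})
  (a_gt0 : forall x, closed_state_space M N x -> 0 < a x).
Local Notation leb := (@lebesgue_measure R).
Local Notation I := (state_space M N).
Local Notation mu := (speed_measure Itheta ca cb a_gt0).
Local Notation nu := (scale_measure Itheta ca cb a_gt0).
Local Notation s := (scale_density theta a b).
Local Notation h := (speed_density theta a b).
Local Notation sigma := (scale_function theta a b).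
Local Notation A := (mass_left Itheta ca cb a_gt0).
Local Notation B := (mass_right Itheta ca cb a_gt0).
Hypothesis mufin : (mu I < +oo)%E.

Let mI : measurable I := measurable_state_space M N.

Variables (x y : R).
Hypotheses (Ix : I x) (Iy : I y) (xy : x < y).

Let sc t : x <= t -> t <= y -> {for t, continuous s}.
Proof.
move=> xt ty; apply: (scale_density_continuous Itheta ca cb a_gt0).
exact: state_space_between xt ty.
Qed.

Let speed_measure_set1 t : I t -> mu [set t] = 0%E.
Proof.
move=> It; rewrite -set_itv1 (speed_measure_itv _ _ _ _ true false It It)//.
by rewrite set_itv1 Rintegral_set1.
Qed.

(** Inside the interval [a h = 1 / s] turns the integrand [a (k s)^2] against the speed measure into
    [k^2 s dx]. Nothing is assumed on [derive1 g] at the corners [x] and [y], which the speed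
    measure does not charge. *)
Lemma dirichlet_form_scale_le (g : R -> R) (k : R) :
  (forall t, x < t -> t < y -> derive1 g t = k * s t) ->
  (forall t, (t < x) || (y < t) -> derive1 g t = 0) ->
  (dirichlet_form M N a mu g <= (k ^+ 2 * (sigma y - sigma x))%:E)%E.
Proof.
move=> g_derive_in g_derive_out.
pose phi t := if t \in `]x, y[ then a t * (k * s t) ^+ 2 else 0.
have a0 t : I t -> 0 <= a t by move=> It; exact/ltW/a_gt0/state_space_closed.
have value t : I t -> exists2 r : R, 0 <= r & r = a t * derive1 g t ^+ 2.
  by move=> It; exists (a t * derive1 g t ^+ 2); rewrite // mulr_ge0 ?sqr_ge0 ?a0.
(* [al] and [be] are whatever values the integrand takes at the two corners. *)
have [al al0 alE] := value _ Ix; have [be be0 beE] := value _ Iy.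
have sub : `]x, y[ `<=` I.
  by apply: subset_trans (state_space_itvcc Ix Iy); exact: subset_itv_oo_cc.
have phi0 t : 0 <= phi t.
  rewrite /phi; case: ifP => // txy; rewrite mulr_ge0 ?sqr_ge0// a0//.
  exact: sub.
have mphixy : measurable_fun `]x, y[ (fun t => a t * (k * s t) ^+ 2).
  apply: measurable_funM.
    exact: measurable_funS sub (diffusion_coefficient_measurable ca).
  apply: measurable_funX; apply: measurable_funM => //.
  exact: (measurable_scale_density_itv Itheta ca cb a_gt0).
have phiE : (fun t => (phi t)%:E) = (fun t => (a t * (k * s t) ^+ 2)%:E) \_ `]x, y[.
  by apply/funext => t; rewrite patchE /phi mem_setE; case: ifP.
have mphi : measurable_fun setT (fun t => (phi t)%:E).
  rewrite phiE; apply/(measurable_restrictT _ (measurable_itv _)).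
  exact/measurable_EFinP.
have mind (r t0 : R) : measurable_fun setT (fun t : measurableTypeR R => (r * \1_[set t0] t)%:E).
  by apply/measurable_EFinP; apply: measurable_funM => //; exact: measurable_indic.
have int_ind (r t0 : R) : 0 <= r -> I t0 -> (\int[mu]_(t in I) (r * \1_[set t0] t)%:E = 0)%E.
  move=> r0 It0; under eq_integral do rewrite EFinM.
  rewrite ge0_integralZl//.
  - rewrite integral_indic// setIidl; last by move=> _ ->.
    by rewrite speed_measure_set1// mule0.
  - exact/measurable_EFinP/measurable_indic.
(* A measurable majorant: [phi] away from the corners, and point indicators of zero integral at
   them. *)
apply: (@le_trans _ _ (\int[mu]_(t in I)
  ((phi t)%:E + (al * \1_[set x] t)%:E + (be * \1_[set y] t)%:E))%E).
  apply: ge0_le_integral_nonmeasurable => t It.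
    by rewrite lee_fin mulr_ge0 ?sqr_ge0 ?a0.
  rewrite -!EFinD lee_fin.
  have hp := phi0 t.
  have ind0 (t0 : R) : 0 <= \1_[set t0] t :> R by rewrite indicE ler0n.
  have hx := mulr_ge0 al0 (ind0 x); have hy := mulr_ge0 be0 (ind0 y).
  have ind1 (t0 : R) : \1_[set t0] t0 = 1 :> R by rewrite indicE mem_set.
  have hsum : [/\ phi t <= phi t + al * \1_[set x] t + be * \1_[set y] t,
      al * \1_[set x] t <= phi t + al * \1_[set x] t + be * \1_[set y] t &
      be * \1_[set y] t <= phi t + al * \1_[set x] t + be * \1_[set y] t].
    move: hp hx hy; move: (phi t) (al * _) (be * _) => p q r p0 q0 r0.
    by split; lra.
  have [phile alle bele] := hsum.
  have [tx|tx] := eqVneq t x.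
    by apply: le_trans alle; rewrite {1}alE tx ind1 mulr1.
  have [ty|ty] := eqVneq t y.
    by apply: le_trans bele; rewrite {1}beE ty ind1 mulr1.
  suff : a t * derive1 g t ^+ 2 <= phi t.
    by move=> /le_trans; apply; exact: phile.
  rewrite /phi; case: ifPn => [|].
    by rewrite in_itv/= => /andP[xt ty']; rewrite g_derive_in.
  move=> txy; have out : (t < x) || (y < t).
    by move: txy; rewrite in_itv/= negb_and -!leNgt !lt_neqAle tx [y == t]eq_sym ty.
  by rewrite (g_derive_out _ out) expr0n mulr0.
rewrite ge0_integralD//; last 4 first.
- by move=> t _; rewrite adde_ge0 ?lee_fin ?phi0 ?mulr_ge0.
- by apply: emeasurable_funD; [exact: measurable_funS mphi|exact: measurable_funS (mind _ _)].
- by move=> t _; rewrite lee_fin mulr_ge0.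
- exact: measurable_funS (mind _ _).
rewrite ge0_integralD//; last 4 first.
- by move=> t _; rewrite lee_fin phi0.
- exact: measurable_funS mphi.
- by move=> t _; rewrite lee_fin mulr_ge0.
- exact: measurable_funS (mind _ _).
rewrite !int_ind// !adde0 phiE -integral_mkcondr setIidr//.
rewrite ge0_integral_speed_measure//; last 2 first.
- exact/measurable_EFinP.
- by move=> t txy; rewrite lee_fin mulr_ge0 ?sqr_ge0// a0//; exact: sub.
have -> : (\int[leb]_(t in `]x, y[) ((a t * (k * s t) ^+ 2)%:E * (h t)%:E) =
    \int[leb]_(t in `]x, y[) ((k ^+ 2)%:E * (s t)%:E))%E.
  apply: eq_integral => t /[!inE] /sub It; rewrite -!EFinM; congr (_%:E).
  rewrite mulrAC (diffusion_speed_density theta b a_gt0 It).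
  by field; rewrite gt_eqF// scale_density_gt0.
have ms : measurable_fun `]x, y[ s by exact: (measurable_scale_density_itv Itheta ca cb a_gt0).
rewrite ge0_integralZl//; last 3 first.
- exact/measurable_EFinP.
- by move=> t _; rewrite lee_fin ltW// scale_density_gt0.
- by rewrite lee_fin sqr_ge0.
rewrite -(integral_itv_bndoo true false); last exact/measurable_EFinP.
have := scale_functionB Itheta ca cb a_gt0 Ix Iy (ltW xy); rewrite -/S /Rintegral.
have sfin : (\int[leb]_(t in `[x, y]) (s t)%:E)%E \is a fin_num.
  by apply: integrable_fin_num => //; exact: (continuous_itv_integrable sc).
by move=> SE; rewrite -(fineK sfin) -SE -EFinM.
Qed.

Let S := sigma y - sigma x.

Let S0 : 0 < S.
Proof. by rewrite subr_gt0; exact: (scale_function_lt Itheta ca cb a_gt0). Qed.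

(** This is [sigma - sigma x] stopped at [x] and [y]: it vanishes to the left of [x] and equals [S]
    to the right of [y]. *)
Definition stopped_scale t := \int[leb]_(u in `[x, clip x y t]) s u.
Local Notation f0 := stopped_scale.

Let clipx t : t <= x -> clip x y t = x.
Proof. by move=> tx; rewrite /clip max_l// ge_min tx. Qed.

Let clipy t : y <= t -> clip x y t = y.
Proof. by move=> yt; rewrite /clip min_r// max_r// ltW. Qed.

Let f0_left t : t <= x -> f0 t = 0.
Proof. by move=> tx; rewrite /f0 clipx// set_itv1 Rintegral_set1. Qed.

Let f0_right t : y <= t -> f0 t = S.
Proof.
by move=> yt; rewrite /f0 clipy// /S (scale_functionB Itheta ca cb a_gt0)// ltW.
Qed.

Let f0_lip : exists2 k : R, 0 <= k &
  forall u v, u <= v -> `|f0 v - f0 u| <= k * (v - u).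
Proof.
have [k Hk] := primitive_lipschitz sc.
exists `|k| => // u v uv; have xyW := ltW xy.
have /andP[xu uy] := clip_in u xyW; have /andP[xv vy] := clip_in v xyW.
apply: le_trans (Hk _ _ xu (clip_homo _ _ uv) vy) _.
apply: le_trans (ler_wpM2r _ (ler_norm k)) _.
  by rewrite subr_ge0 clip_homo.
by apply: ler_wpM2l => //; exact: clip_dist.
Qed.

Let f0_continuous : continuous f0.
Proof.
have [k k0 Hk] := f0_lip; move=> t; apply/cvgrPdist_lt => e e0.
have k1 : 0 < k + 1 by rewrite ltr_wpDl.
near=> u.
have tu : `|t - u| < e / (k + 1).
  by near: u; apply: cvgr_dist_lt; [exact: cvg_id|rewrite divr_gt0].
have : `|f0 t - f0 u| <= k * `|t - u|.
  have [ut|tu'] := leP u t; first by rewrite (ger0_norm (_ : 0 <= t - u)) ?subr_ge0// Hk.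
  by rewrite distrC [`|t - u|]distrC (gtr0_norm (_ : 0 < u - t)) ?subr_gt0// Hk// ltW.
move/le_lt_trans; apply; move: tu; rewrite ltr_pdivlMr// => tu.
apply: le_lt_trans tu; rewrite mulrC ler_wpM2l// lerDl//.
Unshelve. all: by end_near. Qed.

Let f0_measurable : measurable_fun setT f0.
Proof. exact: continuous_measurable_fun. Qed.

Let f0_bounded : exists k : R, forall t, `|f0 t| <= k.
Proof.
have [k k0 Hk] := f0_lip; exists (k * (y - x)) => t.
have xyW := ltW xy; have /andP[xc cy] := clip_in t xyW.
have f0c u : f0 u = f0 (clip x y u).
  by rewrite /f0; have /andP[? ?] := clip_in u xyW; rewrite (clip_id (x := clip x y u)).
rewrite f0c -[f0 _]subr0 -(f0_left (lexx x)); apply: le_trans (Hk _ _ xc) _.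
by rewrite ler_wpM2l// lerB.
Qed.

Let bounded_integrable (g : R -> R) (k : R) : measurable_fun setT g ->
  (forall t, `|g t| <= k) -> mu.-integrable setT (EFin \o g).
Proof.
move=> mg gk; apply: le_integrable (speed_measure_integrable_cst mufin k) => //.
  exact/measurable_EFinP.
by move=> t _; rewrite lee_fin; apply: le_trans (gk t) (ler_norm _).
Qed.

(** The mean of [f0] under the stationary distribution; [n2] below is the variance with respect to
    the unnormalized measure. *)
Let c := fine (\int[mu]_t (f0 t)%:E) / fine (mu I).
Let n2 := fine (\int[mu]_t ((f0 t - c) ^+ 2)%:E).

Let f0_integrable : mu.-integrable setT (EFin \o f0).
Proof. by have [k Hk] := f0_bounded; exact: bounded_integrable Hk. Qed.

Let f0c_measurable : measurable_fun setT (fun t => (f0 t - c) ^+ 2).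
Proof. by apply: measurable_funX; apply: measurable_funB. Qed.

Let n2E : (\int[mu]_t ((f0 t - c) ^+ 2)%:E = n2%:E)%E.
Proof.
rewrite /n2 fineK//; apply: integrable_fin_num => //.
have [k Hk] := f0_bounded.
apply: (@bounded_integrable _ ((k + `|c|) ^+ 2)) => // t.
have k0 : 0 <= k by exact: le_trans (Hk t).
rewrite normrX ler_sqr ?nnegrE ?addr_ge0//.
by rewrite (le_trans (ler_normB _ _))// lerD2r.
Qed.

Let AB := (A x)^-1 + (B y)^-1.

Let AB0 : 0 < AB.
Proof.
by rewrite addr_gt0// invr_gt0; [exact: (mass_left_gt0 mufin)|exact: (mass_right_gt0 mufin)].
Qed.

(** Only the two outer pieces are kept, where [f0] is 0 or [S]; the resulting quadratic in [c] is
    bounded below by its minimum over all real [c]. *)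
Let n2_ge : S ^+ 2 / AB <= n2.
Proof.
have A0 : 0 < A x by exact: (mass_left_gt0 mufin).
have B0 : 0 < B y by exact: (mass_right_gt0 mufin).
apply: (@le_trans _ _ (c ^+ 2 * A x + (S - c) ^+ 2 * B y)).
  rewrite ler_pdivrMr//.
  (* Lagrange's identity: the remainder is the square that measures the defect in Cauchy-Schwarz. *)
  have -> : (c ^+ 2 * A x + (S - c) ^+ 2 * B y) * AB =
      S ^+ 2 + (A x * c - B y * (S - c)) ^+ 2 / (A x * B y).
    by rewrite /AB; field; rewrite !gt_eqF.
  by rewrite lerDl divr_ge0 ?sqr_ge0// mulr_ge0// ltW.
pose E1 : set (measurableTypeR R) := I `&` [set` `]-oo, x]].
pose E2 : set (measurableTypeR R) := I `&` [set` `[y, +oo[].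
have mE1 : measurable E1 by exact: measurableI.
have mE2 : measurable E2 by exact: measurableI.
rewrite -lee_fin -n2E EFinD !EFinM -(mass_leftE mufin) -(mass_rightE mufin).
have int_indic (k : R) (E : set (measurableTypeR R)) : measurable E ->
    ((k ^+ 2)%:E * mu E = \int[mu]_t (k ^+ 2 * \1_E t)%:E)%E.
  move=> mE; under eq_integral do rewrite EFinM.
  rewrite ge0_integralZl//.
  - by rewrite integral_indic// setIT.
  - exact/measurable_EFinP/measurable_indic.
  - by rewrite lee_fin sqr_ge0.
rewrite !int_indic// -ge0_integralD//; last 4 first.
- by move=> t _; rewrite lee_fin mulr_ge0 ?sqr_ge0.
- by apply/measurable_EFinP; apply: measurable_funM => //; exact: measurable_indic.
- by move=> t _; rewrite lee_fin mulr_ge0 ?sqr_ge0.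
- by apply/measurable_EFinP; apply: measurable_funM => //; exact: measurable_indic.
apply: ge0_le_integral_nonmeasurable => t _.
  by rewrite adde_ge0// lee_fin mulr_ge0 ?sqr_ge0.
rewrite -EFinD lee_fin !indicE.
have [tE1|_] := boolP (t \in E1); last first.
  rewrite mulr0 add0r; have [tE2|_] := boolP (t \in E2); last by rewrite mulr0 sqr_ge0.
  move: tE2; rewrite inE => -[_]; rewrite /= in_itv/= andbT => yt.
  by rewrite mulr1 f0_right.
move: tE1; rewrite inE => -[_]; rewrite /= in_itv/= => tx.
rewrite memNset ?mulr1 ?mulr0 ?addr0.
  by rewrite f0_left// sub0r sqrrN.
move=> [_]; rewrite /= in_itv/= andbT => yt.
by have := lt_le_trans xy (le_trans yt tx); rewrite ltxx.
Qed.

Let n2_gt0 : 0 < n2.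
Proof. by apply: lt_le_trans n2_ge; rewrite divr_gt0// exprn_gt0. Qed.

Let n := Num.sqrt n2.
Let n_gt0 : 0 < n. Proof. by rewrite sqrtr_gt0. Qed.
Let nn : n ^+ 2 = n2. Proof. by rewrite sqr_sqrtr// ltW. Qed.

Let g t := n^-1 * (f0 t - c).

Let g_measurable : measurable_fun setT g.
Proof. by apply: measurable_funM => //; apply: measurable_funB. Qed.

Let g_sqr : (\int[mu]_t (g t ^+ 2)%:E = 1)%E.
Proof.
under eq_integral do rewrite /g exprMn EFinM.
rewrite ge0_integralZl//; last 3 first.
- exact/measurable_EFinP.
- by move=> t _; rewrite lee_fin sqr_ge0.
- by rewrite lee_fin sqr_ge0.
have n20 : n2 != 0 by rewrite gt_eqF.
by rewrite n2E -EFinM exprVn nn mulVf.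
Qed.

Let g_norm : ('N[mu]_2%:E[EFin \o g] = 1)%E.
Proof.
rewrite unlock; have -> : (\int[mu]_t (`|(EFin \o g) t| `^ 2) = 1)%E.
  rewrite -g_sqr; apply: eq_integral => t _.
  by rewrite /= ?poweR_EFin powR_mulrn// real_normK// num_real.
by rewrite poweR1r.
Qed.

Let g_admissible : admissible M N theta mu g.
Proof.
split.
- apply/andP; split; first by rewrite inE.
  by rewrite inE/= /finite_norm g_norm ltry.
- move=> u v _ _ e e0; have [k k0 Hk] := f0_lip.
  (* [g] is globally Lipschitz with constant [n^-1 * k]; adding 1 to [k] makes the constant
     invertible. *)
  have k1 : 0 < n^-1 * (k + 1) by rewrite mulr_gt0 ?invr_gt0// ltr_wpDl.
  exists (e / (n^-1 * (k + 1))); first by rewrite divr_gt0.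
  move=> j p q pq _; rewrite ltr_pdivlMr// => pqe; apply: le_lt_trans pqe.
  rewrite mulrC mulr_sumr; apply: ler_sum => i _; have [_ piqi _] := pq i (ltn_ord i).
  rewrite /g -mulrBr opprB addrA subrK normrM gtr0_norm ?invr_gt0// -mulrA.
  rewrite ler_pM2l ?invr_gt0//; apply: le_trans (Hk _ _ piqi) _.
  by apply: ler_wpM2r; rewrite ?subr_ge0// lerDl.
- have int_g : mu.-integrable setT (EFin \o g).
    have [k Hk] := f0_bounded.
    apply: (@bounded_integrable _ (n^-1 * (k + `|c|))) => // t.
    rewrite /g normrM gtr0_norm ?invr_gt0// ler_pM2l ?invr_gt0//.
    by rewrite (le_trans (ler_normB _ _))// lerD2r.
  rewrite integral_stationary_distribution//.
  suff -> : (\int[mu]_t (g t)%:E = 0)%E by rewrite mule0.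
  under eq_integral do rewrite /g EFinM.
  have intfc : mu.-integrable setT (EFin \o (fun t => f0 t - c)).
    rewrite (_ : EFin \o _ = (EFin \o f0) \- (EFin \o cst c))%E//.
    by apply: integrableB => //; exact: speed_measure_integrable_cst.
  rewrite integralZl//; under eq_integral do rewrite EFinB.
  rewrite integralB//; last exact: (speed_measure_integrable_cst mufin c).
  rewrite integral_cst//= speed_measure_setT (speed_measureE mufin).
  have -> : (\int[mu]_t (f0 t)%:E = (fine (\int[mu]_t (f0 t)%:E))%:E)%E.
    by rewrite fineK//; exact: integrable_fin_num.
  have V0 : fine (mu I) != 0 by rewrite gt_eqF//; exact: (speed_mass_gt0 mufin).
  by rewrite -EFinM /c divfK// subrr mulr0.
- exact: g_norm.
Qed.

Let derive1_near (u v : R -> R) t : {near t, u =1 v} -> derive1 u t = derive1 v t.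
Proof. by move=> uv; rewrite !derive1E; exact: near_eq_derive. Qed.

Let g_derive_in t : x < t -> t < y -> derive1 g t = n^-1 * s t.
Proof.
move=> xt ty.
(* Near an interior point [clip] is the identity, so [g] is an affine function of a primitive of
   [s]. *)
rewrite (@derive1_near g (fun t => n^-1 * (\int[leb]_(u in `[x, t]) s u + (- c)))).
  have d := primitive_is_derive sc xt ty.
  rewrite derive1E.
  rewrite (@derive_val _ _ _ _ _ _ _ (is_deriveZ n^-1 (is_deriveD d (is_derive_cst (- c) t 1)))).
  by rewrite addr0.
near=> u; rewrite /g /f0; congr (_ * (_ + _)).
have : u \in `]x, y[ by near: u; apply: near_in_itvoo; rewrite in_itv/= xt.
by rewrite in_itv/= => /andP[xu uy]; rewrite clip_id// ltW.
Unshelve. all: by end_near. Qed.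

Let g_derive_out t : (t < x) || (y < t) -> derive1 g t = 0.
Proof.
case/orP => ht.
- rewrite (@derive1_near g (cst (n^-1 * (0 - c)))) ?derive1_cst//.
  near=> u; rewrite /g f0_left//; apply/ltW; near: u; exact: lt_nbhsl.
- rewrite (@derive1_near g (cst (n^-1 * (S - c)))) ?derive1_cst//.
  near=> u; rewrite /g f0_right//; apply/ltW; near: u; exact: lt_nbhsr.
Unshelve. all: by end_near. Qed.

Let dirichlet_g : (dirichlet_form M N a mu g <= (S / n2)%:E)%E.
Proof.
have -> : S / n2 = n^-1 ^+ 2 * (sigma y - sigma x) by rewrite exprVn nn mulrC.
exact: dirichlet_form_scale_le g_derive_in g_derive_out.
Qed.

(** The test function [g] has energy at most [S / n2], and [n2_ge] bounds this by [AB / S]. *)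
Lemma lambda1_le_kappa_inv_element : (lambda1 M N theta a mu <= (AB / S)%:E)%E.
Proof.
apply: (@le_trans _ _ (S / n2)%:E).
  by apply: le_trans dirichlet_g; apply: ereal_inf_lbound; exists g.
rewrite lee_fin ler_pdivrMr// mulrAC ler_pdivlMr// -expr2.
by move: n2_ge; rewrite ler_pdivrMr// mulrC.
Qed.

End upper_bound.

Theorem theorem10p2 (R : realType) (M N : \bar R) (theta : R) (a b : R -> R)
    (Itheta : state_space M N theta)
    (ca : {within closed_state_space M N, continuous a})
    (cb : {within closed_state_space M N, continuous b})
    (a_gt0 : forall x, closed_state_space M N x -> 0 < a x) :
  let mu := speed_measure Itheta ca cb a_gt0 in
  let nu := scale_measure Itheta ca cb a_gt0 in
  (mu (state_space M N) < +oo)%E ->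
  ((4^-1)%:E * kappa_inv M N mu nu <= lambda1 M N theta a mu
   <= kappa_inv M N mu nu)%E.
Proof.
move=> mu nu mufin; apply/andP; split; first exact: kappa_inv_le_lambda1.
(* For the upper bound each pair [x < y] has its own test function. *)
apply: le_ereal_inf_tmp => _ [[x y] /= [Ix Iy xy] <-].
rewrite (kappa_inv_elementE mufin Ix Iy xy).
exact: lambda1_le_kappa_inv_element.
Qed.
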